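(* Let $N,P\in\mathbb{N}$, let $\sigma=(\sigma_1,\dots,\sigma_P)\in\mathbb{R}^{N\times P}$ (with columns $\sigma_i\in\mathbb{R}^N$), and let $\mu$ be a nonnegative symmetric Radon measure on $\mathbb{R}^N\setminus\{0\}$ satisfying $\int_{|z|>0}\min\{|z|^2,1\}\,\mathrm{d}\mu(z)<\infty$. Let $\varphi:\mathbb{R}\to\mathbb{R}$ be nondecreasing and continuous, and let $f\in L^\infty(\mathbb{R}^N)$. Then there is at most one distributional solution $w$ of $$w-\mathfrak{L}^{\sigma,\mu}[\varphi(w)]=f\quad\text{on }\mathbb{R}^N$$ such that $w\in L^\infty(\mathbb{R}^N)$ and $w-f\in L^1(\mathbb{R}^N)$.
   Context: For $\psi\in C_c^\infty(\mathbb{R}^N)$ the operator is $\mathfrak{L}^{\sigma,\mu}[\psi]:=L^\sigma[\psi]+\mathcal{L}^\mu[\psi]$, where $L^\sigma[\psi](x):=\mathrm{tr}(\sigma\sigma^T D^2\psi(x))=\sum_{i=1}^P(\sigma_i\cdot D)^2\psi(x)$ and $\mathcal{L}^\mu[\psi](x):=\int_{\mathbb{R}^N\setminus\{0\}}\big(\psi(x+z)-\psi(x)-z\cdot D\psi(x)\mathbf{1}_{|z|\le 1}\big)\,\mathrm{d}\mu(z)$. A distributional solution is a function $w\in L^\infty(\mathbb{R}^N)$ such that $\int_{\mathbb{R}^N}\big(w\,\psi-\varphi(w)\,\mathfrak{L}^{\sigma,\mu}[\psi]\big)\,\mathrm{d}x=\int_{\mathbb{R}^N}f\,\psi\,\mathrm{d}x$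 for all $\psi\in C_c^\infty(\mathbb{R}^N)$. *)

(* Defs.v *)
From HB Require Import structures.
From mathcomp Require Import all_boot all_order all_algebra.
From mathcomp Require Import all_classical all_reals all_analysis.
Set Implicit Arguments. Unset Strict Implicit. Unset Printing Implicit Defensive.
Import Order.TTheory GRing.Theory Num.Theory.
Import numFieldNormedType.Exports.
Local Open Scope classical_set_scope.
Local Open Scope ring_scope.

Definition RN (R : realType) (N : nat) := g_sigma_algebraType (@open 'rV[R]_N).

(* Euclidean norm |z| on R^N (MathComp's own norm on matrices is the sup-norm). *)
Definition enorm (R : realType) (N : nat) (z : 'rV[R]_N) : R :=
  Num.sqrt (\sum_(j < N) z ord0 j ^+ 2).

(* lam is Lebesgue measure on the Borel sets of R^N: it gives closed boxes their volume.
   (This determines the Borel measure uniquely.) *)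
Definition is_lebesgue (R : realType) (N : nat)
    (lam : {measure set (RN R N) -> \bar R}) : Prop :=
  forall a b : 'rV[R]_N, (forall j, a ord0 j <= b ord0 j) ->
    lam [set x : RN R N | forall j, a ord0 j <= x ord0 j <= b ord0 j] =
    (\prod_(j < N) (b ord0 j - a ord0 j))%:E.

Definition iterD (R : realType) (N : nat) (vs : seq 'rV[R]_N)
    (g : 'rV[R]_N -> R) : 'rV[R]_N -> R :=
  foldr (fun v h => fun x => derive h x v) g vs.

Definition smooth (R : realType) (N : nat) (g : 'rV[R]_N -> R) : Prop :=
  forall (vs : seq 'rV[R]_N) (x : 'rV[R]_N), differentiable (iterD vs g) x.

Definition test_fun (R : realType) (N : nat) (psi : 'rV[R]_N -> R) : Prop :=
  smooth psi /\ compact (closure [set x | psi x != 0]).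

Definition Lsigma (R : realType) (N P : nat) (sigma : 'M[R]_(N, P))
    (psi : 'rV[R]_N -> R) (x : 'rV[R]_N) : R :=
  \sum_(i < P) derive (fun y => derive psi y (col i sigma)^T) x (col i sigma)^T.

Definition Lmu (R : realType) (N : nat) (mu : {measure set (RN R N) -> \bar R})
    (psi : 'rV[R]_N -> R) (x : 'rV[R]_N) : R :=
  fine (\int[mu]_(z in [set~ ((0%R : 'rV[R]_N) : RN R N)])
          (psi (x + z) - psi x - (if enorm z <= 1 then 'd psi x z else 0))%R%:E)%E.

Definition Lop (R : realType) (N P : nat) (sigma : 'M[R]_(N, P))
    (mu : {measure set (RN R N) -> \bar R}) (psi : 'rV[R]_N -> R) (x : 'rV[R]_N) : R :=
  Lsigma sigma psi x + Lmu mu psi x.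

Definition Linfty (R : realType) (N : nat) (lam : {measure set (RN R N) -> \bar R})
    (w : 'rV[R]_N -> R) : Prop :=
  measurable_fun [set: RN R N] (w : RN R N -> R) /\
  exists M : R, {ae lam, forall x, `|w x| <= M}.

Definition L1 (R : realType) (N : nat) (lam : {measure set (RN R N) -> \bar R})
    (w : 'rV[R]_N -> R) : Prop :=
  lam.-integrable [set: RN R N] (fun x => (w x)%:E).

Definition dist_solution (R : realType) (N P : nat) (lam : {measure set (RN R N) -> \bar R})
    (sigma : 'M[R]_(N, P)) (mu : {measure set (RN R N) -> \bar R})
    (phi : R -> R) (f w : 'rV[R]_N -> R) : Prop :=
  Linfty lam w /\
  forall psi : 'rV[R]_N -> R, test_fun psi ->
    (\int[lam]_x (w x * psi x - phi (w x) * Lop sigma mu psi x)%R%:E =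
     \int[lam]_x (f x * psi x)%R%:E)%E.

(* Main.v *)
(** With W = w1 - w2 and Phi = phi(w1) - phi(w2), subtracting the two equations
gives W = L Phi in the sense of distributions, and Phi W >= 0 by monotonicity.
Once the integral of Phi W is shown to be nonpositive, Phi W = 0 almost
everywhere; since Phi = 0 wherever W = 0, this forces Phi = 0, hence W = 0.

For an even mollifier rho put u = rho * Phi and g = rho * W, so that g = L u
pointwise, where L u is built from the second differences
u(x+z) + u(x-z) - 2 u(x): integrated in z against mu / 2, and, along the columns
of sigma, as the limit of rescaled second differences.  If T is nondecreasing
and T(u) is integrable, then for each z
  int T(u) (u(x+z) + u(x-z) - 2 u(x)) dx
    = - int (T(u(x+z)) - T(u(x))) (u(x+z) - u(x)) dx <= 0,
so int T(u) g <= 0.  As phi is uniformly continuous on bounded sets,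
|Phi| <= eta + C |W| for every eta > 0; hence the soft thresholding
T_eta(u) = sign(u) max(|u| - eta, 0) satisfies |T_eta(u)| <= C rho * |W|, which is
integrable although Phi itself is only bounded.  Letting eta -> 0 gives
int u g <= 0, and shrinking the mollifier gives int Phi W <= 0. *)

Require Import Defs.
From HB Require Import structures.
From mathcomp Require Import all_boot all_order all_algebra.
From mathcomp Require Import all_classical all_reals all_analysis.
From mathcomp Require Import measurable_realfun ring lra.
Import Order.TTheory GRing.Theory Num.Theory.
Import numFieldNormedType.Exports.
Local Open Scope classical_set_scope.
Local Open Scope ring_scope.
Set Implicit Arguments. Unset Strict Implicit. Unset Printing Implicit Defensive.

(** * Borel sets and Lebesgue measure on R^N *)

(** The equations are tested only with the translates [rho(x - .)] of a mollifier, so the operator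
    has to be moved from the kernel onto [u] although [Phi] is merely bounded. What permits this is
    an L1 bound on the kernel: the integral over x of [|rho(x+z) + rho(x-z) - 2 rho(x)|] is at most
    [C min(|z|^2, 1)]. It makes Fubini applicable against [Phi] and [mu], and it bounds the second
    differences of [u] by a multiple of [min(|z|^2, 1)] uniformly in x. No derivative of [u] is ever
    taken.

    Shrinking the mollifier relies on L1 convergence for [W] alone. Convolution with an even kernel
    is self-adjoint, so int Phi W is compared with int Phi g = int u W, and that with int u g, each
    time at the cost sup|Phi| times the L1 norm of g - W. Likewise, once Phi = 0, the tested
    equation gives g = 0 at every scale, and g -> W in L1 yields W = 0.

    Lebesgue measure is given through the volumes of closed boxes, so its invariance under
    translations and reflections is derived from uniqueness. The solutions are bounded only almost
    everywhere and are replaced by truncated representatives. *)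

Definition cbox {R : realType} {N : nat} (a b : 'rV[R]_N) : set (RN R N) :=
  [set x : RN R N | forall j, a ord0 j <= (x : 'rV[R]_N) ord0 j <= b ord0 j].

Definition rat_row {R : realType} {N : nat} (a : 'rV[rat]_N) : 'rV[R]_N :=
  \row_j ratr (a ord0 j).

Lemma open_rat_cbox (R : realType) (N : nat) (O : set 'rV[R]_N) (x : 'rV[R]_N) :
  open O -> O x -> exists p : 'rV[rat]_N * 'rV[rat]_N,
    cbox (rat_row p.1) (rat_row p.2) x /\ cbox (rat_row p.1) (rat_row p.2) `<=` O.
Proof.
move=> oO Ox.
have /nbhs_ballP[e /= e0 xeO] : nbhs x O by exact: open_nbhs_nbhs.
have Ha j : {q : rat | (x ord0 j - e < ratr q < x ord0 j)}.
  apply: cid; have [q] := @rat_in_itvoo R (x ord0 j - e) (x ord0 j) ltac:(lra).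
  by rewrite in_itv/= => ?; exists q.
have Hb j : {q : rat | (x ord0 j < ratr q < x ord0 j + e)}.
  apply: cid; have [q] := @rat_in_itvoo R (x ord0 j) (x ord0 j + e) ltac:(lra).
  by rewrite in_itv/= => ?; exists q.
exists (\row_j sval (Ha j), \row_j sval (Hb j)); split => /=.
  move=> j; rewrite !mxE; move: (svalP (Ha j)) (svalP (Hb j)).
  by move=> /andP[_ /ltW->] /andP[/ltW-> _].
move=> y xy; apply: xeO; split=> // i j; rewrite [i]ord1 /ball/=.
have := xy j; rewrite !mxE; move: (svalP (Ha j)) (svalP (Hb j)).
move=> /andP[h1 h2] /andP[h3 h4] /andP[h5 h6].
rewrite ltr_norml; apply/andP; split; lra.
Qed.

(** There are countably many boxes with rational endpoints, so the boxes on which Lebesgue measure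
    is prescribed generate the Borel sets. Closed boxes are used because [is_lebesgue] speaks of
    them. *)
Lemma open_bigcup_cbox (R : realType) (N : nat) (O : set 'rV[R]_N) : open O ->
  O = \bigcup_(p in [set p : 'rV[rat]_N * 'rV[rat]_N |
        cbox (rat_row p.1) (rat_row p.2) `<=` O])
      (cbox (rat_row p.1) (rat_row p.2) : set 'rV[R]_N).
Proof.
move=> oO; apply/seteqP; split=> [x Ox|x [p /= +]]; last exact.
by have [p [xp pO]] := open_rat_cbox oO Ox; exists p.
Qed.

Lemma measurable_open (R : realType) (N : nat) (O : set 'rV[R]_N) :
  open O -> measurable (O : set (RN R N)).
Proof. by move=> oO; exact: sub_sigma_algebra. Qed.

Lemma measurable_continuousRN (R : realType) (N : nat) (f : 'rV[R]_N -> R) :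
  continuous f -> measurable_fun [set: RN R N] (f : RN R N -> R).
Proof.
move=> cf; apply: (measurability _ (RGenOInfty.measurableE R)).
move=> _ [_ [a ->] <-]; rewrite setTI; apply: measurable_open.
by move/continuousP: cf; apply; exact: interval_open.
Qed.

Lemma measurable_coordRN (R : realType) (N : nat) (j : 'I_N) :
  measurable_fun [set: RN R N] (fun x : RN R N => (x : 'rV[R]_N) ord0 j).
Proof. by apply: measurable_continuousRN => x; exact: coord_continuous. Qed.

Lemma cboxE (R : realType) (N : nat) (a b : 'rV[R]_N) : cbox a b =
  \bigcap_(j in [set: 'I_N])
    ((fun x : RN R N => (x : 'rV[R]_N) ord0 j) @^-1` `[a ord0 j, b ord0 j]%classic).
Proof.
apply/seteqP; split=> [x h j _ /=|x h j]; first by rewrite in_itv/=; exact: h.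
by have := h j I; rewrite /= in_itv.
Qed.

Lemma measurable_preimage_cbox d (T : measurableType d) (R : realType) (N : nat)
    (F : T -> RN R N) (a b : 'rV[R]_N) :
  (forall j, measurable_fun [set: T] (fun t => (F t : 'rV[R]_N) ord0 j)) ->
  measurable (F @^-1` cbox a b).
Proof.
move=> mF; rewrite cboxE preimage_bigcap; apply: fin_bigcap_measurable.
  exact: finite_finset.
move=> j _; rewrite -comp_preimage -[X in measurable X]setTI.
by apply: mF.
Qed.

Lemma measurable_cbox (R : realType) (N : nat) (a b : 'rV[R]_N) :
  measurable (cbox a b).
Proof.
by apply: (@measurable_preimage_cbox _ _ _ _ id) => j; exact: measurable_coordRN.
Qed.

Lemma countable_bigcup_measurable d (T : measurableType d) (I : countType)
    (P : set I) (F : I -> set T) :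
  (forall i, P i -> measurable (F i)) -> measurable (\bigcup_(i in P) F i).
Proof.
move=> mF; rewrite bigcup_mkcond; apply: countable_bigcupT_measurable => // i.
by case: ifPn => // /set_mem /mF.
Qed.

(** The sigma-algebra of [RN] is generated by open sets, not by coordinates; cutting an open set
    into countably many boxes turns its preimage into coordinate conditions. Addition and scaling of
    vector-valued maps, also on product spaces, become measurable this way. *)
Lemma measurable_fun_coordP d (T : measurableType d) (R : realType) (N : nat)
    (F : T -> RN R N) :
  (forall j, measurable_fun [set: T] (fun t => (F t : 'rV[R]_N) ord0 j)) ->
  measurable_fun [set: T] F.
Proof.
move=> mF; apply: (@measurability _ _ T (RN R N) setT F (@open 'rV[R]_N)) => //.
move=> _ [U oU <-]; rewrite setTI (open_bigcup_cbox oU) preimage_bigcup.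
apply: countable_bigcup_measurable => p _.
exact: measurable_preimage_cbox.
Qed.

Lemma measurable_fun_coord d (T : measurableType d) (R : realType) (N : nat)
    (F : T -> RN R N) (j : 'I_N) : measurable_fun [set: T] F ->
  measurable_fun [set: T] (fun t => (F t : 'rV[R]_N) ord0 j).
Proof. by move=> mF; apply: (measurableT_comp (@measurable_coordRN R N j)). Qed.

Lemma measurable_funDRN d (T : measurableType d) (R : realType) (N : nat)
    (F G : T -> RN R N) : measurable_fun [set: T] F -> measurable_fun [set: T] G ->
  measurable_fun [set: T] (fun t => (F t : 'rV[R]_N) + G t : RN R N).
Proof.
move=> mF mG; apply: measurable_fun_coordP => j.
under eq_fun do rewrite mxE.
by apply: measurable_funD; exact: measurable_fun_coord.
Qed.

Lemma measurable_funZRN d (T : measurableType d) (R : realType) (N : nat)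
    (F : T -> RN R N) (r : R) : measurable_fun [set: T] F ->
  measurable_fun [set: T] (fun t => r *: (F t : 'rV[R]_N) : RN R N).
Proof.
move=> mF; apply: measurable_fun_coordP => j.
under eq_fun do rewrite mxE.
by apply: measurable_funM; [exact: measurable_cst|exact: measurable_fun_coord].
Qed.

Lemma measurable_funBRN d (T : measurableType d) (R : realType) (N : nat)
    (F G : T -> RN R N) : measurable_fun [set: T] F -> measurable_fun [set: T] G ->
  measurable_fun [set: T] (fun t => (F t : 'rV[R]_N) - G t : RN R N).
Proof.
move=> mF mG; apply: measurable_funDRN => //.
under eq_fun do rewrite -scaleN1r.
exact: measurable_funZRN.
Qed.

Lemma measurable_enorm (R : realType) (N : nat) :
  measurable_fun [set: RN R N] (@enorm R N : RN R N -> R).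
Proof.
have -> : @enorm R N = Num.sqrt \o (fun z => \sum_(j < N) z ord0 j ^+ 2) by [].
apply: measurableT_comp.
  by apply: continuous_measurable_fun; exact: sqrt_continuous.
by apply: measurable_sum => j; apply: measurable_funX; exact: measurable_coordRN.
Qed.

Definition cube {R : realType} {N : nat} (k : nat) : set (RN R N) :=
  cbox (\row_j (- k%:R)) (\row_j k%:R).

Lemma cube_cover (R : realType) (N : nat) : \bigcup_k (@cube R N k) = setT.
Proof.
apply/seteqP; split=> // x _.
exists (Num.truncn `|x : 'rV[R]_N|).+1 => // j; rewrite !mxE -ler_norml.
apply: le_trans (ltW (truncnS_gt _)).
have -> : `|x : 'rV[R]_N| = mx_norm (x : 'rV[R]_N) by [].
rewrite mx_normrE.
exact: (le_bigmax _ (fun i : 'I_1 * 'I_N => `|x i.1 i.2|) (ord0, j)).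
Qed.

Lemma measurable_RN_cbox (R : realType) (N : nat) :
  (@measurable _ (RN R N)) =
  <<s [set A : set (RN R N) | A = set0 \/ exists a b, A = cbox a b] >>.
Proof.
apply/seteqP; split=> A.
- move=> mA; apply: (smallest_sub _ _ mA); first exact: smallest_sigma_algebra.
  move=> O oO; rewrite (open_bigcup_cbox oO).
  apply: (@countable_bigcup_measurable _ (g_sigma_algebraType [set A : set (RN R N) | A = set0 \/ exists a b, A = cbox a b])).
    by move=> p _; apply: sub_sigma_algebra; right; do 2 eexists.
- move=> sA; apply: (smallest_sub _ _ sA); first exact: sigma_algebra_measurable.
  by move=> _ [->|[a [b ->]]]; [exact: measurable0|exact: measurable_cbox].
Qed.

(** Closed boxes are stable under intersection, generate the Borel sets and contain an exhausting
    sequence of finite measure, so agreement on boxes propagates. A box with an inverted side is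
    empty and has measure 0 on both sides. *)
Lemma lebesgue_unique (R : realType) (N : nat)
    (m1 m2 : {measure set (RN R N) -> \bar R}) :
  is_lebesgue m1 -> is_lebesgue m2 ->
  forall A, measurable A -> m1 A = m2 A.
Proof.
move=> L1 L2 A mA.
have box_eq a b : m1 (cbox a b) = m2 (cbox a b).
  have [ab|] := pselect (forall j, a ord0 j <= b ord0 j).
    by rewrite /cbox L1// L2.
  move/existsNP => [j /negP]; rewrite -ltNge => baj.
  suff -> : cbox a b = set0 by rewrite !measure0.
  by apply/seteqP; split=> // x /(_ j) /andP[h1 h2]; have := le_trans h1 h2; rewrite leNgt baj.
apply: (@measure_unique _ _ _ _ (@cube R N) (measurable_RN_cbox R N)) => //.
- move=> _ _ [->|[a [b ->]]] [->|[a' [b' ->]]]; try by left; rewrite ?set0I ?setI0.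
  right; exists (\row_j Num.max (a ord0 j) (a' ord0 j)), (\row_j Num.min (b ord0 j) (b' ord0 j)).
  apply/seteqP; split=> [x [h1 h2] j|x h]; last split=> j.
  + by rewrite !mxE ge_max le_min; move: (h1 j) (h2 j) => /andP[-> ->] /andP[-> ->].
  + by have := h j; rewrite !mxE ge_max le_min => /andP[/andP[-> _] /andP[-> _]].
  + by have := h j; rewrite !mxE ge_max le_min => /andP[/andP[_ ->] /andP[_ ->]].
- by move=> k; right; do 2 eexists.
- exact: cube_cover.
- by move=> B [->|[a [b ->]]]; rewrite ?measure0.
- move=> k; rewrite /cube L1 ?ltry// => j; rewrite !mxE.
  by rewrite lerNl (le_trans _ (ler0n _ k))// oppr_le0.
Qed.

(** The image measure again gives closed boxes their volume, so uniqueness applies. The boolean [s]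
    treats translations and point reflections together; a reflection swaps the two corners of the
    box, whence the case distinction in [c] and [d]. *)
Lemma lebesgue_affine (R : realType) (N : nat)
    (lam : {measure set (RN R N) -> \bar R}) (s : bool) (h : 'rV[R]_N) :
  is_lebesgue lam ->
  forall A, measurable A ->
    lam ((fun x : RN R N => (-1) ^+ s *: (x : 'rV[R]_N) + h : RN R N) @^-1` A) = lam A.
Proof.
move=> L A mA.
have mf : measurable_fun [set: RN R N]
    (fun x : RN R N => (-1) ^+ s *: (x : 'rV[R]_N) + h : RN R N).
  apply: measurable_funDRN; last exact: measurable_cst.
  by apply: measurable_funZRN; exact: measurable_id.
pose f : {mfun RN R N >-> RN R N} := mfun_Sub (mem_set mf).
have := @lebesgue_unique R N (pushforward lam f) lam _ L A mA.
apply; move=> a b ab; rewrite /pushforward/=.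
pose c := if s then h - b else a - h; pose d := if s then h - a else b - h.
transitivity (lam (cbox c d)).
  congr (lam _); apply/seteqP; split=> x /= hx j; have := hx j; rewrite /c /d;
  by case: (s); rewrite ?expr1 ?expr0 !mxE; lra.
rewrite /cbox L; last by move=> j; have := ab j; rewrite /c /d; case: (s); rewrite !mxE; lra.
by congr (_%:E); apply: eq_bigr => j _; rewrite /c /d; case: (s); rewrite !mxE; lra.
Qed.

(** * Integration of real-valued functions, Fubini, change of variables *)

Notation Int m f := (m.-integrable setT (fun x => (f x)%:E)).

Section real_integral.
Context d (T : measurableType d) (R : realType) (m : {measure set T -> \bar R}).
Implicit Types f g : T -> R.

Lemma Int_measurable f : Int m f -> measurable_fun setT f.
Proof. by move/measurable_int/measurable_EFinP. Qed.

Lemma Int_le g f : measurable_fun setT f -> (forall x, `|f x| <= g x) ->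
  Int m g -> Int m f.
Proof.
move=> mf fg; apply: le_integrable => //; first exact/measurable_EFinP.
by move=> x _; rewrite lee_fin (le_trans (fg x))// ler_norm.
Qed.

Lemma IntD f g : Int m f -> Int m g -> Int m (fun x => f x + g x).
Proof. by move=> h1 h2; have := integrableD measurableT h1 h2. Qed.

Lemma IntB f g : Int m f -> Int m g -> Int m (fun x => f x - g x).
Proof. by move=> h1 h2; have := integrableB measurableT h1 h2. Qed.

Lemma IntZ (k : R) f : Int m f -> Int m (fun x => k * f x).
Proof. by move=> h1; have := integrableZl measurableT k h1. Qed.

Lemma Int_norm f : Int m f -> Int m (fun x => `|f x|).
Proof. by move=> h1; have := integrable_abse h1. Qed.

Lemma IntM (M : R) f g : measurable_fun setT g -> (forall x, `|g x| <= M) ->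
  Int m f -> Int m (fun x => g x * f x).
Proof.
move=> mg gM If; apply: (@Int_le (fun x => M * `|f x|)).
- by apply: measurable_funM => //; exact: Int_measurable.
- by move=> x; rewrite normrM ler_wpM2r.
- exact/IntZ/Int_norm.
Qed.

Lemma RintD f g : Int m f -> Int m g ->
  \int[m]_x (f x + g x) = \int[m]_x f x + \int[m]_x g x.
Proof. exact: RintegralD. Qed.

Lemma RintB f g : Int m f -> Int m g ->
  \int[m]_x (f x - g x) = \int[m]_x f x - \int[m]_x g x.
Proof. exact: RintegralB. Qed.

Lemma RintZ (k : R) f : Int m f -> \int[m]_x (k * f x) = k * \int[m]_x f x.
Proof. exact: RintegralZl. Qed.

Lemma Rint_le f g : Int m f -> Int m g -> (forall x, f x <= g x) ->
  \int[m]_x f x <= \int[m]_x g x.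
Proof. by move=> If Ig fg; apply: le_Rintegral. Qed.

Lemma Rint_norm f : Int m f -> `|\int[m]_x f x| <= \int[m]_x `|f x|.
Proof. exact: le_normr_Rintegral. Qed.

Lemma Rint_norm_le f g : Int m f -> Int m g -> (forall x, `|f x| <= g x) ->
  `|\int[m]_x f x| <= \int[m]_x g x.
Proof.
move=> If Ig fg; apply: le_trans (Rint_norm If) _.
by apply: Rint_le => //; exact: Int_norm.
Qed.

Lemma EFin_Rint f : Int m f -> (\int[m]_x f x)%:E = (\int[m]_x (f x)%:E)%E.
Proof. by move=> If; rewrite /Rintegral fineK//; exact: integrable_fin_num. Qed.

Lemma Int_ge0P f : measurable_fun setT f -> (forall x, 0 <= f x) ->
  (\int[m]_x (f x)%:E < +oo)%E -> Int m f.
Proof.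
move=> mf f0 foo; apply/integrableP; split; first exact/measurable_EFinP.
by under eq_integral do rewrite gee0_abs ?lee_fin ?f0//.
Qed.

Lemma Rint_DCT (f_ : nat -> T -> R) f g :
  (forall n, measurable_fun setT (f_ n)) -> (forall x, f_ ^~ x @ \oo --> f x) ->
  Int m g -> (forall n x, `|f_ n x| <= g x) ->
  Int m f /\ (fun n => \int[m]_x f_ n x) @ \oo --> \int[m]_x f x.
Proof.
move=> mf_ f_f Ig fg.
have mf : measurable_fun setT f.
  by apply: (measurable_fun_cvg mf_) => x _; exact: f_f.
have mf_E n : measurable_fun setT (fun x => (f_ n x)%:E) by exact/measurable_EFinP.
have mfE : measurable_fun setT (fun x => (f x)%:E) by exact/measurable_EFinP.
have [||If _ H] := @dominated_convergence _ T R m setT measurableT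
  (fun n x => (f_ n x)%:E) (fun x => (f x)%:E) (fun x => (g x)%:E) mf_E mfE _ Ig.
- by apply: aeW => x _; apply: cvg_EFin; [exact: nearW|exact: f_f].
- by apply: aeW => x n _; exact: fg.
by split=> //; apply: fine_cvg; rewrite EFin_Rint.
Qed.

Lemma Rint_eq0 f : Int m f -> (forall x, 0 <= f x) -> \int[m]_x f x = 0 ->
  {ae m, forall x, f x = 0}.
Proof.
move=> If f0 H.
have : (\int[m]_x `|(f x)%:E| = 0)%E.
  by under eq_integral do rewrite gee0_abs ?lee_fin ?f0//; rewrite -EFin_Rint// H.
move/(ae_eq_integral_abs m measurableT (measurable_int _ If)).
by apply: filterS => x /(_ I) [].
Qed.

Lemma ae_Rint f g : measurable_fun setT f -> measurable_fun setT g ->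
  {ae m, forall x, f x = g x} -> \int[m]_x f x = \int[m]_x g x.
Proof.
move=> mf mg fg; congr fine; apply: ae_eq_integral => //; try exact/measurable_EFinP.
by apply: filterS fg => x /= -> .
Qed.

End real_integral.

(** The library states Fubini's theorem for bundled sigma-finite measures; here
    sigma-finiteness is only available as a hypothesis. *)
Section fubini_wrappers.
Context d1 d2 (T1 : measurableType d1) (T2 : measurableType d2) (R : realType).
Variables (m1 : {measure set T1 -> \bar R}) (m2 : {measure set T2 -> \bar R}).
Hypotheses (s1 : sigma_finite setT m1) (s2 : sigma_finite setT m2).

Let M1 : {sigma_finite_measure set T1 -> \bar R} :=
  HB.pack_for {sigma_finite_measure set T1 -> \bar R} (Measure.sort m1)
    (isSigmaFinite.Build d1 T1 R (Measure.sort m1) s1)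
    (isSFinite.Build d1 T1 R (Measure.sort m1) (sfinite_measure_sigma_finite s1)).
Let M2 : {sigma_finite_measure set T2 -> \bar R} :=
  HB.pack_for {sigma_finite_measure set T2 -> \bar R} (Measure.sort m2)
    (isSigmaFinite.Build d2 T2 R (Measure.sort m2) s2)
    (isSFinite.Build d2 T2 R (Measure.sort m2) (sfinite_measure_sigma_finite s2)).

(** The integrable majorant [h] of the inner absolute integrals gives integrability on the product.
    Every section, not almost every one, is required to be integrable, so that the real-valued inner
    integrals agree with the extended ones at each point. *)
Lemma sf_fubini (f : T1 * T2 -> R) (h : T1 -> R) : measurable_fun setT f ->
  (forall x, Int m2 (fun y => f (x, y))) -> (forall y, Int m1 (fun x => f (x, y))) ->
  Int m1 h -> (forall x, \int[m2]_y `|f (x, y)| <= h x) ->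
  [/\ Int m1 (fun x => \int[m2]_y f (x, y)), Int m2 (fun y => \int[m1]_x f (x, y))
    & \int[m1]_x \int[m2]_y f (x, y) = \int[m2]_y \int[m1]_x f (x, y)].
Proof.
move=> mf I2 I1 Ih fh.
have If : (M1 \x M2)%E.-integrable setT (fun z => (f z)%:E).
  apply/integrable12ltyP; first exact/measurable_EFinP.
  have := integrable_lty measurableT Ih; apply: le_lt_trans.
  have mabs : measurable_fun setT (fun z => `|(f z)%:E|%E).
    by apply: measurableT_comp => //; exact/measurable_EFinP.
  apply: ge0_le_integral => //.
  - by move=> x _; apply: integral_ge0.
  - exact: (@measurable_fun_fubini_tonelli_F _ _ _ _ _ M2 _ mabs).
  - by apply/measurable_EFinP/Int_measurable/Ih.
  - move=> x _; have := fh x; rewrite -lee_fin EFin_Rint; first by [].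
    exact: (Int_norm (I2 x)).
have E2 x : (\int[m2]_y f (x, y))%:E = (\int[m2]_y (f (x, y))%:E)%E by exact: EFin_Rint.
have E1 y : (\int[m1]_x f (x, y))%:E = (\int[m1]_x (f (x, y))%:E)%E by exact: EFin_Rint.
split.
- under eq_fun do rewrite E2; exact: (integrable_fubini_F If).
- under eq_fun do rewrite E1.
  have mfE : measurable_fun setT (fun z => (f z)%:E) by exact/measurable_EFinP.
  have mabs : measurable_fun setT (fun z => `|(f z)%:E|%E).
    by apply: measurableT_comp.
  have mG := @measurable_fubini_G _ _ _ _ _ M1 M2 _ If.
  apply/integrableP; split; first exact: mG.
  apply: le_lt_trans ((integrable21ltyP M1 M2 mfE).1 If).
  apply: ge0_le_integral => //.
  + by apply: measurableT_comp => //; exact: mG.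
  + exact: (@measurable_fun_fubini_tonelli_G _ _ _ _ _ M1 _ mabs).
  + move=> y _; apply: le_abse_integral => //.
    by apply/measurable_EFinP/(Int_measurable (I1 y)).
- congr fine; under eq_integral do rewrite E2.
  under [RHS]eq_integral do rewrite E1.
  exact: (Fubini If).
Qed.

End fubini_wrappers.

Lemma sf_tonelli_measurable d1 d2 (T1 : measurableType d1) (T2 : measurableType d2)
    (R : realType) (m2 : {measure set T2 -> \bar R}) (s2 : sigma_finite setT m2)
    (f : T1 * T2 -> \bar R) : measurable_fun setT f -> (forall z, 0 <= f z)%E ->
  measurable_fun setT (fun x => \int[m2]_y f (x, y))%E.
Proof.
pose M2 : {sigma_finite_measure set T2 -> \bar R} :=
  HB.pack_for {sigma_finite_measure set T2 -> \bar R} (Measure.sort m2)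
    (isSigmaFinite.Build d2 T2 R (Measure.sort m2) s2)
    (isSFinite.Build d2 T2 R (Measure.sort m2) (sfinite_measure_sigma_finite s2)).
by move=> mf f0; exact: (@measurable_fun_fubini_tonelli_F _ _ _ _ _ M2 _ mf).
Qed.

Section preserving.
Context d1 (T : measurableType d1) (R : realType).
Variables (m : {measure set T -> \bar R}) (tau : T -> T).
Hypotheses (mtau : measurable_fun setT tau)
  (ptau : forall A, measurable A -> m (tau @^-1` A) = m A).

Lemma preserving_integral (f : T -> \bar R) : measurable_fun setT f ->
  (forall x, 0 <= f x)%E -> (\int[m]_x f (tau x) = \int[m]_x f x)%E.
Proof.
move=> mf f0.
pose t : {mfun T >-> T} := mfun_Sub (mem_set mtau).
have := @ge0_integral_pushforward _ _ T T R t (measurable_funPT t) m setT f measurableT mf (fun y _ => f0 y).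
rewrite preimage_setT => <-.
by apply: eq_measure_integral => A mA _; exact: ptau.
Qed.

Lemma preserving_Int (f : T -> R) : Int m f -> Int m (fun x => f (tau x)).
Proof.
move=> If; have mf := Int_measurable If; apply/integrableP; split.
  by apply/measurable_EFinP/measurableT_comp.
rewrite (preserving_integral (f := fun x => `|(f x)%:E|%E))//.
- by have /integrableP[] := If.
- by apply: measurableT_comp => //; exact/measurable_EFinP.
Qed.

Lemma preserving_Rint (f : T -> R) : Int m f ->
  \int[m]_x f (tau x) = \int[m]_x f x.
Proof.
move=> If; have mf := Int_measurable If.
pose t : {mfun T >-> T} := mfun_Sub (mem_set mtau).
have /= := @integral_pushforward _ _ T T R t (measurable_funPT t) m setT (fun x => (f x)%:E)
  ((measurable_EFinP _ _).2 mf) (preserving_Int If) measurableT.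
rewrite /Rintegral preimage_setT => <-.
by congr fine; apply: eq_measure_integral => A mA _; exact: ptau.
Qed.

End preserving.

(** * Convolution with an even kernel *)

Lemma cvg0_le (R : realType) (u : nat -> R) (e : R) : u @ \oo --> 0 -> 0 < e ->
  \forall n \near \oo, u n <= e.
Proof.
move=> /cvgrPdist_le + e0 => /(_ e e0); apply: filterS => n.
by rewrite sub0r normrN; apply: le_trans; exact: ler_norm.
Qed.

(** The splitting [f = (f + |f|) - |f|] reduces the claim to Tonelli. Only the sections have to be
    integrable, which is the situation when a bounded function is mollified. *)
Lemma sf_measurable_Rint d1 d2 (T1 : measurableType d1) (T2 : measurableType d2)
    (R : realType) (m2 : {measure set T2 -> \bar R}) (f : T1 * T2 -> R) :
  sigma_finite setT m2 -> measurable_fun setT f ->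
  (forall x, Int m2 (fun y => f (x, y))) ->
  measurable_fun setT (fun x => \int[m2]_y f (x, y)).
Proof.
move=> s2 mf If.
have pos (g : T1 * T2 -> R) : measurable_fun setT g -> (forall z, 0 <= g z) ->
    (forall x, Int m2 (fun y => g (x, y))) ->
    measurable_fun setT (fun x : T1 => \int[m2]_y g (x, y)).
  move=> mg g0 Ig; apply/measurable_EFinP.
  rewrite (_ : _ \o _ = fun x => (\int[m2]_y (g (x, y))%:E)%E); last first.
    by apply/funext => x /=; rewrite EFin_Rint.
  by apply: (sf_tonelli_measurable s2 (f := fun z => (g z)%:E)); [exact/measurable_EFinP|move=> z; rewrite lee_fin].
have mn : measurable_fun setT (fun z => `|f z|) by exact: measurableT_comp.
rewrite (_ : (fun x => _) =
    fun x => \int[m2]_y (f (x, y) + `|f (x, y)|) - \int[m2]_y `|f (x, y)|).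
  apply: measurable_funB; last first.
    by apply: (pos (fun z => `|f z|)) => // x; exact: (Int_norm (If x)).
  apply: (pos (fun z => f z + `|f z|)).
  - exact: measurable_funD.
  - by move=> z; rewrite -lerBlDr sub0r lerNl -normrN ler_norm.
  - by move=> x; exact: (IntD (If x) (Int_norm (If x))).
by apply/funext => x; rewrite (RintD (If x) (Int_norm (If x))) addrK.
Qed.

Section lebesgue.
Context (R : realType) (N : nat).
Variable (lam : {measure set (RN R N) -> \bar R}).
Hypothesis L : is_lebesgue lam.
Local Notation V := (RN R N).

Lemma cube_lty k : (lam (cube k) < +oo)%E.
Proof.
rewrite /cube L ?ltry// => j; rewrite !mxE.
by rewrite lerNl (le_trans _ (ler0n _ k))// oppr_le0.
Qed.

Lemma lebesgue_sigma_finite : sigma_finite setT lam.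
Proof.
exists (@cube R N); first by rewrite cube_cover.
by move=> k; split; [exact: measurable_cbox|exact: cube_lty].
Qed.

Lemma measurable_shift (h : V) :
  measurable_fun setT (fun x : V => (x : 'rV[R]_N) + h : V).
Proof. by apply: measurable_funDRN; [exact: measurable_id|exact: measurable_cst]. Qed.

Lemma measurable_reflect (h : V) :
  measurable_fun setT (fun x : V => (h : 'rV[R]_N) - x : V).
Proof. by apply: measurable_funBRN; [exact: measurable_cst|exact: measurable_id]. Qed.

Lemma lebesgue_shift (h : V) (A : set V) : measurable A ->
  lam ((fun x : V => (x : 'rV[R]_N) + h : V) @^-1` A) = lam A.
Proof.
move=> mA; rewrite -[RHS](lebesgue_affine false h L mA); congr (lam _).
by apply/seteqP; split => x /=; rewrite scale1r.
Qed.

Lemma lebesgue_reflect (h : V) (A : set V) : measurable A ->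
  lam ((fun x : V => (h : 'rV[R]_N) - x : V) @^-1` A) = lam A.
Proof.
move=> mA; rewrite -[RHS](lebesgue_affine true h L mA); congr (lam _).
by apply/seteqP; split => x /=; rewrite expr1 scaleN1r addrC.
Qed.

Lemma Int_shift (h : V) (f : V -> R) : Int lam f ->
  Int lam (fun x : V => f ((x : 'rV[R]_N) + h)).
Proof. exact: (preserving_Int (measurable_shift h) (lebesgue_shift h)). Qed.

Lemma Rint_shift (h : V) (f : V -> R) : Int lam f ->
  \int[lam]_x f ((x : 'rV[R]_N) + h) = \int[lam]_x f x.
Proof. exact: (preserving_Rint (measurable_shift h) (lebesgue_shift h)). Qed.

Lemma Int_reflect (h : V) (f : V -> R) : Int lam f ->
  Int lam (fun x : V => f ((h : 'rV[R]_N) - x)).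
Proof. exact: (preserving_Int (measurable_reflect h) (lebesgue_reflect h)). Qed.

Lemma Rint_reflect (h : V) (f : V -> R) : Int lam f ->
  \int[lam]_x f ((h : 'rV[R]_N) - x) = \int[lam]_x f x.
Proof. exact: (preserving_Rint (measurable_reflect h) (lebesgue_reflect h)). Qed.

Record is_kernel (rho : V -> R) : Prop := IsKernel {
  kernel_measurable : measurable_fun setT rho ;
  kernel_ge0 : forall x, 0 <= rho x ;
  kernel_bounded : exists C, forall x, rho x <= C ;
  kernel_integrable : Int lam rho ;
  kernel_mass : \int[lam]_x rho x = 1 ;
  kernel_even : forall x : 'rV[R]_N, rho (- x) = rho x }.

Definition convol (rho F : V -> R) (x : V) : R :=
  \int[lam]_y (F y * rho ((x : 'rV[R]_N) - y)).

Section kernel.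
Variable rho : V -> R.
Hypothesis K : is_kernel rho.

Lemma kernel_norm x : `|rho x| = rho x.
Proof. by rewrite ger0_norm// (kernel_ge0 K). Qed.

Lemma kernelC (x y : 'rV[R]_N) : rho (x - y) = rho (y - x).
Proof. by rewrite -(kernel_even K) opprB. Qed.

Lemma measurable_sub_pair :
  measurable_fun setT (fun p : V * V => (p.1 : 'rV[R]_N) - p.2 : V).
Proof. by apply: measurable_funBRN. Qed.

Lemma measurable_kernel2 :
  measurable_fun setT (fun p : V * V => rho ((p.1 : 'rV[R]_N) - p.2)).
Proof. exact: (measurableT_comp (kernel_measurable K) measurable_sub_pair). Qed.

Lemma convol_integrand_measurable (F : V -> R) : measurable_fun setT F ->
  measurable_fun setT (fun p : V * V => F p.2 * rho ((p.1 : 'rV[R]_N) - p.2)).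
Proof.
move=> mF; apply: measurable_funM; last exact: measurable_kernel2.
exact: measurableT_comp.
Qed.

Lemma Int_kernel (x : V) : Int lam (fun y : V => rho ((x : 'rV[R]_N) - y)).
Proof. exact: Int_reflect (kernel_integrable K). Qed.

Lemma Rint_kernel (x : V) : \int[lam]_y rho ((x : 'rV[R]_N) - y) = 1.
Proof. by rewrite Rint_reflect ?(kernel_mass K)//; exact: kernel_integrable K. Qed.

Lemma Int_convol_bounded (F : V -> R) M x : measurable_fun setT F -> (forall y, `|F y| <= M) ->
  Int lam (fun y => F y * rho ((x : 'rV[R]_N) - y)).
Proof. by move=> mF FM; apply: (IntM (M := M)) => //; exact: Int_kernel. Qed.

Lemma Int_convol_integrable F x : Int lam F ->
  Int lam (fun y => F y * rho ((x : 'rV[R]_N) - y)).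
Proof.
move=> IF; have [C rhoC] := kernel_bounded K.
under eq_fun do rewrite mulrC.
apply: (IntM (M := C)) => //; last by move=> y; rewrite kernel_norm.
exact: Int_measurable (Int_kernel x).
Qed.

Lemma convol_bounded (F : V -> R) M x : measurable_fun setT F -> (forall y, `|F y| <= M) ->
  `|convol rho F x| <= M.
Proof.
move=> mF FM; rewrite -[leRHS]mulr1 -(Rint_kernel x) -RintZ; last exact: Int_kernel.
apply: Rint_norm_le; first exact: Int_convol_bounded FM.
  by apply: IntZ; exact: Int_kernel.
by move=> y; rewrite normrM kernel_norm ler_wpM2r// (kernel_ge0 K).
Qed.

Lemma convol_measurable (F : V -> R) M : measurable_fun setT F -> (forall y, `|F y| <= M) ->
  measurable_fun setT (convol rho F).
Proof.
move=> mF FM; apply: (sf_measurable_Rint lebesgue_sigma_finite (convol_integrand_measurable mF)).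
by move=> x; exact: Int_convol_bounded FM.
Qed.

(** Fubini with the integration in [x] done first: each translated kernel has mass 1. The preserved
    total integral is used for indicators in the L1 convergence of mollifications. *)
Lemma convol_integrable F : Int lam F ->
  Int lam (convol rho F) /\ \int[lam]_x convol rho F x = \int[lam]_x F x.
Proof.
move=> IF; have mF := Int_measurable IF.
pose f (p : V * V) := F p.1 * rho ((p.2 : 'rV[R]_N) - p.1).
have mf : measurable_fun setT f.
  apply: measurable_funM; first exact: measurableT_comp.
  by apply: (measurableT_comp (kernel_measurable K)); exact: measurable_funBRN.
have I2 y : Int lam (fun x => f (y, x)).
  by rewrite /f /=; apply: IntZ; exact: (Int_shift (- y) (kernel_integrable K)).
have I1 x : Int lam (fun y => f (y, x)) by exact: Int_convol_integrable.
have [|_ IG E] := sf_fubini lebesgue_sigma_finite lebesgue_sigma_finite mf I2 I1 (Int_norm IF).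
  move=> y; rewrite /f /=; under eq_Rintegral do rewrite normrM kernel_norm.
  rewrite RintZ; last exact: (Int_shift (- y) (kernel_integrable K)).
  by rewrite (Rint_shift (- y) (kernel_integrable K)) (kernel_mass K) mulr1.
split; first exact: IG.
rewrite -[LHS]E; apply: eq_Rintegral => y _; rewrite /f /=.
rewrite RintZ; last exact: (Int_shift (- y) (kernel_integrable K)).
by rewrite (Rint_shift (- y) (kernel_integrable K)) (kernel_mass K) mulr1.
Qed.

Lemma convol_norm_le F x : Int lam F -> `|convol rho F x| <= convol rho (fun y => `|F y|) x.
Proof.
move=> IF; apply: Rint_norm_le; first exact: Int_convol_integrable.
  by apply: Int_convol_integrable; exact: Int_norm.
by move=> y; rewrite normrM kernel_norm.
Qed.

Lemma convol_L1 F : Int lam F -> \int[lam]_x `|convol rho F x| <= \int[lam]_x `|F x|.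
Proof.
move=> IF; have [I1 _] := convol_integrable IF; have [I2 <-] := convol_integrable (Int_norm IF).
by apply: Rint_le => //; [exact: Int_norm|move=> x; exact: convol_norm_le].
Qed.

Lemma convolB F G x : Int lam F -> Int lam G ->
  convol rho (fun y => F y - G y) x = convol rho F x - convol rho G x.
Proof.
move=> IF IG; rewrite /convol; under eq_Rintegral do rewrite mulrBl.
by rewrite RintB//; exact: Int_convol_integrable.
Qed.

Lemma convolD F G x : Int lam F -> Int lam G ->
  convol rho (fun y => F y + G y) x = convol rho F x + convol rho G x.
Proof.
move=> IF IG; rewrite /convol; under eq_Rintegral do rewrite mulrDl.
by rewrite RintD//; exact: Int_convol_integrable.
Qed.

Lemma convolZ c F x : Int lam F ->
  convol rho (fun y => c * F y) x = c * convol rho F x.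
Proof.
move=> IF; rewrite /convol; under eq_Rintegral do rewrite -mulrA.
by rewrite RintZ//; exact: Int_convol_integrable.
Qed.

(** Since the kernel is even, Fubini carries the mollification from the bounded factor over to the
    integrable one. *)
Lemma convol_adjoint (Phi W : V -> R) M : measurable_fun setT Phi -> (forall y, `|Phi y| <= M) ->
  Int lam W ->
  \int[lam]_x (convol rho Phi x * W x) = \int[lam]_y (Phi y * convol rho W y).
Proof.
move=> mP PM IW; have mW := Int_measurable IW.
pose f (p : V * V) := W p.1 * (Phi p.2 * rho ((p.1 : 'rV[R]_N) - p.2)).
have mf : measurable_fun setT f.
  apply: measurable_funM; last exact: convol_integrand_measurable.
  exact: measurableT_comp.
have I2 x : Int lam (fun y => f (x, y)).
  by rewrite /f /=; apply: IntZ; exact: Int_convol_bounded PM.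
have I1E x y : f (x, y) = Phi y * (W x * rho ((y : 'rV[R]_N) - x)).
  by rewrite /f /= kernelC mulrCA.
have I1 y : Int lam (fun x => f (x, y)).
  by under eq_fun do rewrite I1E; apply: IntZ; exact: Int_convol_integrable.
have [|_ _ E] := sf_fubini lebesgue_sigma_finite lebesgue_sigma_finite mf I2 I1 (IntZ M (Int_norm IW)).
  move=> x; rewrite /f /=; under eq_Rintegral do rewrite normrM.
  rewrite RintZ; last by apply: Int_norm; exact: Int_convol_bounded PM.
  rewrite mulrC ler_wpM2r//.
  rewrite -[leRHS]mulr1 -(Rint_kernel x) -RintZ; last exact: Int_kernel.
  apply: Rint_le; [by apply: Int_norm; exact: Int_convol_bounded PM|by apply: IntZ; exact: Int_kernel|].
  by move=> y; rewrite normrM kernel_norm ler_wpM2r// (kernel_ge0 K).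
transitivity (\int[lam]_x \int[lam]_y f (x, y)).
  apply: eq_Rintegral => x _; rewrite /f /= RintZ; last exact: Int_convol_bounded PM.
  by rewrite mulrC.
rewrite E; apply: eq_Rintegral => y _.
under eq_Rintegral do rewrite I1E.
by rewrite (RintZ _ (Int_convol_integrable y IW)).
Qed.

End kernel.
End lebesgue.

(** * Density of indicators of open sets in L1, and L1 convergence of mollifications *)

Section density.
Context (R : realType) (N : nat).
Variable (lam : {measure set (RN R N) -> \bar R}).
Hypothesis L : is_lebesgue lam.
Local Notation V := (RN R N).

Lemma Int_indic (A : set V) : measurable A -> (lam A < +oo)%E ->
  Int lam (\1_A : V -> R).
Proof.
move=> mA Afin; apply: Int_ge0P => [|x|]; first exact: measurable_indic.
  by rewrite indicE.
by rewrite integral_indic// setIT.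
Qed.

Lemma Rint_DCT0 (f_ : nat -> V -> R) (f g : V -> R) :
  (forall n, measurable_fun setT (f_ n)) -> measurable_fun setT f ->
  (forall x, f_ ^~ x @ \oo --> f x) -> Int lam g ->
  (forall n x, `|f x - f_ n x| <= g x) ->
  (fun n => \int[lam]_x `|f x - f_ n x|) @ \oo --> (0 : R).
Proof.
move=> mf_ mf f_f Ig fg.
have [||||_] := @Rint_DCT _ V R lam (fun n x => `|f x - f_ n x|) (fun _ => 0) g.
- by move=> n; apply: measurableT_comp => //; exact: measurable_funB.
- move=> x; rewrite -(normr0 R) -(subrr (f x)).
  by apply: cvg_norm; apply: cvgB; [exact: cvg_cst|exact: f_f].
- exact: Ig.
- by move=> n x; rewrite normr_id.
by rewrite Rintegral_cst// mul0r.
Qed.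

(** * An induction principle for integrable functions *)

Section closure.
Variable P : (V -> R) -> Prop.
Hypothesis P_open : forall A : set V, @open 'rV[R]_N A -> (lam A < +oo)%E -> P \1_A.
Hypothesis PD : forall F G, P F -> P G -> P (fun x => F x + G x).
Hypothesis PZ : forall c F, P F -> P (fun x => c * F x).
Hypothesis P_lim : forall F, Int lam F ->
  (forall e, 0 < e -> exists G, [/\ P G, Int lam G & \int[lam]_x `|F x - G x| <= e]) ->
  P F.

(** Open cubes, unlike the closed [cube], have indicators to which [P_open] applies directly. *)
Definition ocube (k : nat) : set V := [set x | forall j, `|(x : 'rV[R]_N) ord0 j| < k%:R].

Lemma ocube_open k : @open 'rV[R]_N (ocube k).
Proof.
rewrite openE => x xk; rewrite /interior.
apply: (@filter_forall _ _ (fun j (y : 'rV[R]_N) => `|y ord0 j| < k%:R) (nbhs x) _) => j.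
have Hc : (y : 'rV[R]_N) ord0 j @[y --> x] --> x ord0 j by exact: coord_continuous.
have Ho : nbhs (x ord0 j) [set t : R | `|t| < k%:R].
  apply: open_nbhs_nbhs; split; last exact: xk.
  rewrite (_ : [set t | _] = ball (0 : R) k%:R); first exact: ball_open.
  by apply/seteqP; split=> t; rewrite /ball/= sub0r normrN.
exact: Hc Ho.
Qed.

Lemma measurable_ocube k : measurable (ocube k).
Proof. exact: (measurable_open (@ocube_open k)). Qed.

Lemma ocube_lty k : (lam (ocube k) < +oo)%E.
Proof.
apply: le_lt_trans (cube_lty L k); apply: le_measure; rewrite ?inE//.
- exact: measurable_ocube.
- exact: measurable_cbox.
by move=> x h j; rewrite !mxE; have := h j; rewrite -ler_norml => /ltW.
Qed.

Lemma ocube_cvg (F : V -> R) x : (fun k => F x * \1_(ocube k) x) @ \oo --> F x.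
Proof.
apply: cvg_near_cst; exists (Num.truncn `|x : 'rV[R]_N|).+2 => // k /= xk.
rewrite indicE mem_set ?mulr1// => j.
apply: (@lt_le_trans _ _ (Num.truncn `|x : 'rV[R]_N|).+1%:R); last by rewrite ler_nat ltnW.
apply: le_lt_trans (truncnS_gt _).
have -> : `|x : 'rV[R]_N| = mx_norm (x : 'rV[R]_N) by [].
rewrite mx_normrE.
exact: (le_bigmax _ (fun i : 'I_1 * 'I_N => `|x i.1 i.2|) (ord0, j)).
Qed.

Lemma closure_zero : P (fun=> 0).
Proof.
have -> : (fun=> 0) = (fun x : V => 0 * \1_(ocube 0) x :> R).
  by apply/funext => x; rewrite mul0r.
apply: PZ; apply: P_open; [exact: ocube_open|exact: ocube_lty].
Qed.

Lemma closure_sum n (F : 'I_n -> V -> R) : (forall i, P (F i)) -> P (fun x => \sum_(i < n) F i x).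
Proof.
elim: n F => [F _|n IH F PF]; first by under eq_fun do rewrite big_ord0; exact: closure_zero.
under eq_fun do rewrite big_ord_recr.
by apply: PD => //; exact: IH.
Qed.

(** Dynkin induction from the open sets, which are stable under intersection. Inside a fixed open
    cube all measures are finite, so a complement becomes a difference of indicators and a countable
    disjoint union becomes an L1 limit of its finite partial unions. *)
Lemma closure_indic_ocube k (A : set V) : measurable A -> P \1_(A `&` ocube k).
Proof.
apply: (@dynkin_induction _ V (@open 'rV[R]_N) (fun A => P \1_(A `&` ocube k))) => //.
- by move=> B C; exact: openI.
- by rewrite setTI; exact: (P_open (@ocube_open k) (ocube_lty k)).
- move=> U oU; apply: P_open; first exact: (openI oU (@ocube_open k)).
  apply: le_lt_trans (ocube_lty k); apply: le_measure; rewrite ?inE//.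
    by apply: measurableI; [exact: (measurable_open oU)|exact: measurable_ocube].
  exact: measurable_ocube.
- move=> {}A mA PA.
  have -> : \1_(~` A `&` ocube k) = fun x => \1_(ocube k) x + (-1) * \1_(A `&` ocube k) x :> R.
    apply/funext => x; rewrite !indicI /= !indicE in_setC.
    by case: (x \in A); case: (x \in _); rewrite /=; ring.
  by apply: PD; [exact: (P_open (@ocube_open k) (ocube_lty k))|exact: PZ].
- move=> F mF tF PF.
  pose U n := \bigcup_(i < n) F i.
  have mU n : measurable (U n) by apply: bigcup_measurable.
  have PU n : P \1_(U n `&` ocube k).
    elim: n => [|n IH].
      suff -> : \1_(U 0%N `&` ocube k) = (fun=> 0) :> (V -> R) by exact: closure_zero.
      apply/funext => x; rewrite indicE memNset// => -[[i]] //.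
    suff -> : \1_(U n.+1 `&` ocube k) =
        (fun x => \1_(U n `&` ocube k) x + \1_(F n `&` ocube k) x) :> (V -> R).
      exact: PD.
    have -> : U n.+1 = U n `|` F n.
      apply/seteqP; split=> [x [i /=]|x [[i /= ilt Fi]|Fn]].
      - by rewrite ltnS leq_eqVlt => /predU1P[->|ilt] Fi; [right|left; exists i].
      - by exists i => //=; exact: ltnW.
      - by exists n => /=.
    apply/funext => x; rewrite !indicI /= !indicE in_setU.
    have : x \in U n -> x \in F n -> False.
      move=> /set_mem[i /= ilt Fi] /set_mem Fn.
      have /trivIsetP/(_ i n I I) := tF; rewrite ltn_eqF// => /(_ isT).
      by move/seteqP => -[/(_ x (conj Fi Fn))].
    by case: (x \in U n); case: (x \in F n); case: (x \in ocube k) => //= H; rewrite /=; try ring; case: (H isT isT).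
  have IFU (B : set V) : measurable B -> Int lam (\1_(B `&` ocube k) : V -> R).
    move=> mB; have mBk := measurableI _ _ mB (measurable_ocube k).
    apply: Int_indic => //; apply: le_lt_trans (ocube_lty k).
    by apply: le_measure; rewrite ?inE//; exact: measurable_ocube.
  have mUU : measurable (\bigcup_i F i) by exact: bigcupT_measurable.
  apply: P_lim; first exact: IFU.
  have : (fun n => \int[lam]_x `|\1_((\bigcup_i F i) `&` ocube k) x - \1_(U n `&` ocube k) x|) @ \oo --> (0 : R).
    apply: (@Rint_DCT0 _ _ (\1_(ocube k))).
    - by move=> n; exact: Int_measurable (IFU _ (mU n)).
    - exact: Int_measurable (IFU _ mUU).
    - move=> x; apply: cvg_near_cst.
      have [[i _ Fi]|nF] := pselect ((\bigcup_i F i) x).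
        exists i.+1 => // n /= ni; rewrite !indicI /= !indicE.
        have -> : x \in U n by apply: mem_set; exists i.
        by have -> : x \in \bigcup_i F i by apply: mem_set; exists i.
      apply: nearW => n; rewrite !indicI /= !indicE.
      have -> : x \in U n = false by apply: memNset => -[j _ Fj]; apply: nF; exists j.
      by have -> : x \in \bigcup_i F i = false by exact: memNset.
    - exact: (Int_indic (measurable_ocube k) (ocube_lty k)).
    - move=> n x; rewrite !indicI /= !indicE.
      have : x \in U n -> x \in \bigcup_i F i.
        by move=> /set_mem[i _ Fi]; apply: mem_set; exists i.
      case: (x \in U n); case: (x \in \bigcup_i F i); case: (x \in ocube k) => //= H;
       rewrite ?mul0r ?mul1r ?mulr0 ?subrr ?normr0 ?subr0 ?normr1 ?mulr1//; by have := H isT.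
  move=> H e e0; have [n _ /(_ n (leqnn n)) Hn] := cvg0_le H e0.
  by exists (\1_(U n `&` ocube k)); split=> //; exact: IFU.
Qed.

Import HBSimple.

Lemma closure_sfun_ocube k (g : {sfun V >-> R}) : P (fun x => g x * \1_(ocube k) x).
Proof.
under eq_fun do rewrite fimfunEord mulr_suml.
apply: closure_sum => i; under eq_fun do rewrite -mulrA.
apply: PZ.
rewrite (_ : (fun x => _) = \1_(g @^-1` [set (finmap.enum_fset (fset_set (range g)))`_i] `&` ocube k)).
  exact: closure_indic_ocube.
by apply/funext => x; rewrite indicI /=.
Qed.

(** The approximant is a simple function cut off to a large cube. Its distance to [F] is at most the
    cut-off error of [F] plus the distance of the simple function to [F], because the indicator is
    at most 1; each part costs [e / 2]. *)
Lemma L1_induction F : Int lam F -> P F.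
Proof.
move=> IF; have mF := Int_measurable IF.
have mo k : measurable_fun setT (\1_(ocube k) : V -> R) by exact: (measurable_indic (measurable_ocube k)).
have o1 k x : `|\1_(ocube k) x| <= 1 :> R.
  by rewrite indicE; case: (_ \in _); rewrite ?normr1 ?normr0.
have Io k G : Int lam G -> Int lam (fun x => G x * \1_(ocube k) x).
  by move=> IG; under eq_fun do rewrite mulrC; apply: IntM (o1 k) IG.
apply: P_lim => // e e0.
have H1 : (fun k => \int[lam]_x `|F x - F x * \1_(ocube k) x|) @ \oo --> (0 : R).
  apply: (@Rint_DCT0 _ _ (fun x => `|F x|)) => //.
  - by move=> k; exact: Int_measurable (Io k _ IF).
  - exact: ocube_cvg.
  - exact: Int_norm.
  - move=> k x; rewrite -{1}(mulr1 (F x)) -mulrBr normrM ler_piMr//.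
    by rewrite indicE; case: (_ \in _); rewrite ?subrr ?normr0 ?subr0 ?normr1.
have e20 : 0 < e / 2 by lra.
have [k _ /(_ k (leqnn k)) Hk] := cvg0_le H1 e20.
have [g_ [Ig _ H2]] := approximation_sfun_integrable measurableT IF.
have H2' : (fun n => \int[lam]_x `|F x - g_ n x|) @ \oo --> (0 : R) by exact: fine_cvg H2.
have [n _ /(_ n (leqnn n)) Hn] := cvg0_le H2' e20.
have Igk := Io k _ (Ig n).
exists (fun x => g_ n x * \1_(ocube k) x); split; [exact: closure_sfun_ocube|exact: Igk|].
have I1 := IntB IF (Io k _ IF); have I2 := IntB IF (Ig n).
apply: (@le_trans _ _ (\int[lam]_x (`|F x - F x * \1_(ocube k) x| + `|F x - g_ n x|))).
  apply: Rint_le.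
  - by apply: Int_norm; exact: IntB.
  - by apply: IntD; exact: Int_norm.
  - move=> x; rewrite (_ : F x - _ = (F x - F x * \1_(ocube k) x) + (F x - g_ n x) * \1_(ocube k) x); last by ring.
    by apply: le_trans (ler_normD _ _) _; rewrite lerD2l normrM ler_piMr.
by rewrite RintD; [|exact: Int_norm|exact: Int_norm]; lra.
Qed.

End closure.

(** * L1 convergence of mollifications *)

Section mollification.
Variable rho : nat -> V -> R.
Hypothesis K : forall n, is_kernel lam (rho n).
Hypothesis supp : forall (U : set 'rV[R]_N), open U -> U 0 ->
  \forall n \near \oo, forall x : 'rV[R]_N, rho n x != 0 -> U x.

Lemma mollify_L1 F : Int lam F ->
  (fun n => \int[lam]_x `|convol lam (rho n) F x - F x|) @ \oo --> (0 : R).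
Proof.
move=> IF0.
(* Integrability is carried inside the induction predicate because the linearity of the
   mollification in its second argument uses it. *)
suff [_] : Int lam F /\ forall e, 0 < e ->
    \forall n \near \oo, \int[lam]_x `|convol lam (rho n) F x - F x| <= e.
  move=> H; apply/cvgrPdist_le => e e0; near=> n.
  rewrite sub0r normrN ger0_norm ?Rintegral_ge0//.
  by near: n; exact: H.
have Ic n G : Int lam G -> Int lam (convol lam (rho n) G) by move=> /(convol_integrable L (K n))[].
have Id n G : Int lam G -> Int lam (fun x => `|convol lam (rho n) G x - G x|).
  by move=> IG; apply: Int_norm; apply: IntB => //; exact: Ic.
move: F IF0; apply: L1_induction => [A oA Afin|F G [IF HF] [IG HG]|c F [IF HF]|F IF HF].
- have mA : measurable (A : set V) by exact: measurable_open.
  have IA := Int_indic mA Afin; split=> // e e0.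
  have mi : measurable_fun setT (\1_A : V -> R) by exact: measurable_indic.
  have i1 x : `|\1_A x| <= 1 :> R.
    by rewrite indicE; case: (_ \in _); rewrite ?normr1 ?normr0.
  have i0 x : 0 <= \1_A x :> R by rewrite indicE.
  have c1 n x : convol lam (rho n) \1_A x <= 1.
    by apply: le_trans (convol_bounded L (K n) x mi i1); exact: ler_norm.
  have c0 n x : 0 <= convol lam (rho n) \1_A x.
    by apply: Rintegral_ge0 => y _; rewrite mulr_ge0// (kernel_ge0 (K n)).
  (* Around a point of the open set, a sufficiently concentrated kernel sees only [A], so the
     mollified indicator is exactly 1 there. *)
  have ae x : A x -> \forall n \near \oo, convol lam (rho n) \1_A x = 1.
    move=> Ax.
    pose x' : 'rV[R]_N := x.
    have oU : open [set h : 'rV[R]_N | A (x' - h)].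
      have /continuousP/(_ A oA) // : continuous (fun h : 'rV[R]_N => x' - h).
      by move=> h; apply: continuousB; [exact: cst_continuous|exact: cvg_id].
    have U0 : [set h : 'rV[R]_N | A (x' - h)] 0 by rewrite /= subr0.
    have := supp oU U0; apply: filterS => n Hn.
    rewrite -(Rint_kernel L (K n) x); apply: eq_Rintegral => y _; rewrite indicE.
    have [->|/Hn] := eqVneq (rho n ((x : 'rV[R]_N) - y)) 0; first by rewrite mulr0.
    by rewrite /= subKr => Ay; rewrite mem_set// mul1r.
  (* Since [0 <= c <= 1] for [c = rho * 1_A], [|c - 1_A| = (c - 1_A) + 2 1_A (1 - c)],
     and the first term has integral 0; openness gives [c -> 1] on [A]. *)
  pose D n x := \1_A x * (1 - convol lam (rho n) \1_A x).
  have mD n : measurable_fun setT (D n).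
    apply: measurable_funM => //; apply: measurable_funB => //.
    exact: Int_measurable (Ic n _ IA).
  have D1 n x : `|D n x| <= \1_A x.
    rewrite /D normrM (ger0_norm (i0 x)) ler_piMr// ger0_norm ?subr_ge0//.
    by rewrite gerBl.
  have IDn n : Int lam (D n) by exact: Int_le (D1 n) IA.
  have [||||_ HD] := @Rint_DCT _ V R lam D (fun=> 0) \1_A.
  - exact: mD.
  - move=> x; apply: cvg_near_cst; rewrite /D indicE.
    have [Ax|nAx] := pselect (A x); last by rewrite memNset//; apply: nearW => n; rewrite mul0r.
    by rewrite mem_set//; apply: filterS (ae x Ax) => n ->; rewrite subrr mulr0.
  - exact: IA.
  - exact: D1.
  rewrite Rintegral_cst// mul0r in HD.
  have e2 : 0 < e / 2 by lra.
  apply: filterS (cvg0_le HD e2) => n Hn.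
  have -> : \int[lam]_x `|convol lam (rho n) \1_A x - \1_A x| =
      \int[lam]_x ((convol lam (rho n) \1_A x - \1_A x) + 2 * D n x).
    apply: eq_Rintegral => x _; rewrite /D; have := c1 n x; have := c0 n x.
    rewrite indicE; case: (x \in A) => /= h0 h1.
      by rewrite ler0_norm ?subr_le0//; ring.
    by rewrite subr0 ger0_norm//; ring.
  rewrite RintD; [|exact: IntB (Ic n _ IA) IA|exact: IntZ].
  rewrite RintB//; last exact: Ic.
  by have [_ ->] := convol_integrable L (K n) IA; rewrite subrr add0r RintZ//; lra.
- split; first exact: IntD.
  move=> e e0; have e2 : 0 < e / 2 by lra.
  apply: filterS2 (HF _ e2) (HG _ e2) => n h1 h2.
  apply: (@le_trans _ _ (\int[lam]_x (`|convol lam (rho n) F x - F x| + `|convol lam (rho n) G x - G x|))).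
    apply: Rint_le; [exact: Id (IntD IF IG)|exact: IntD (Id n _ IF) (Id n _ IG)|move=> x].
    by rewrite (convolD L (K n))// opprD addrACA ler_normD.
  by rewrite RintD; [lra|exact: Id|exact: Id].
- split; first exact: IntZ.
  move=> e e0; have e2 : 0 < e / (`|c| + 1) by rewrite divr_gt0// ltr_wpDl.
  apply: filterS (HF _ e2) => n h1.
  have -> : \int[lam]_x `|convol lam (rho n) (fun x => c * F x) x - c * F x| =
     \int[lam]_x (`|c| * `|convol lam (rho n) F x - F x|).
    by apply: eq_Rintegral => x _; rewrite (convolZ L (K n))// -mulrBr normrM.
  rewrite RintZ; last exact: Id.
  rewrite ler_pdivlMr ?ltr_wpDl// in h1.
  have : 0 <= \int[lam]_x `|convol lam (rho n) F x - F x| by exact: Rintegral_ge0.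
  by nra.
- split=> // e e0; have e3 : 0 < e / 3 by lra.
  have [G [[IG HG] _ FG]] := HF _ e3.
  apply: filterS (HG _ e3) => n h1.
  have IFG := IntB IF IG.
  (* The three terms are the mollified error, bounded through the L1 contraction [convol_L1], the
     known convergence for [G], and the approximation error itself. *)
  have : \int[lam]_x `|convol lam (rho n) F x - F x| <=
      \int[lam]_x ((`|convol lam (rho n) (fun y => F y - G y) x| + `|convol lam (rho n) G x - G x|) + `|F x - G x|).
    apply: Rint_le; [exact: Id| |move=> x].
      apply: IntD; last exact: Int_norm.
      by apply: IntD; [apply: Int_norm; exact: Ic|exact: Id].
    rewrite (convolB L (K n))//.
    rewrite (_ : convol lam (rho n) F x - F x = ((convol lam (rho n) F x - convol lam (rho n) G x) + (convol lam (rho n) G x - G x)) - (F x - G x)); last by ring.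
    by apply: le_trans (ler_normB _ _) _; rewrite lerD2r; exact: ler_normD.
  rewrite RintD; [|by apply: IntD; [apply: Int_norm; exact: Ic|exact: Id]|exact: Int_norm].
  rewrite RintD; [|by apply: Int_norm; exact: Ic|exact: Id].
  have := convol_L1 L (K n) IFG.
  by lra.
Unshelve. all: by end_near. Qed.

End mollification.
End density.

(** * A class of smooth functions stable under directional derivatives *)

Section flat.
Context (R : realType).
Implicit Types (p : {poly R}) (s t : R).

(** Coefficientwise from [s^i <= i! exp(s)], which explains the constant. At [s = 1/t] it controls
    the flat functions near 0. *)
Lemma horner_le_expR p : exists2 C, 0 <= C & forall s, 0 <= s -> `|p.[s]| <= C * expR s.
Proof.
exists (\sum_(i < size p) `|p`_i| * i`!%:R) => [|s s0].
  by apply: sumr_ge0 => i _; rewrite mulr_ge0.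
rewrite horner_coef mulr_suml; apply: le_trans (ler_norm_sum _ _ _) _.
apply: ler_sum => i _; rewrite normrM -mulrA ler_wpM2l// ger0_norm ?exprn_ge0//.
case: (i : nat) => [|k]; first by rewrite expr0 fact0 mul1r -expR0 ler_expR.
rewrite -ler_pdivrMl ?ltr0n ?fact_gt0// mulrC.
by have := expR_ge1Dxn k s0; lra.
Qed.

(** For [p = 1] this is the usual flat function; the factor [p.[1/t]] makes the
    family stable under derivation: [(p(s) exp(-s))' = s^2 (p(s) - p'(s)) exp(-s)]
    for [s = 1/t]. *)
Definition flat p t : R := if 0 < t then p.[t^-1] * expR (- t^-1) else 0.

Lemma flat_bounded p : exists C, forall t, `|flat p t| <= C.
Proof.
have [C C0 HC] := horner_le_expR p; exists C => t; rewrite /flat.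
case: ifPn => [t0|_]; last by rewrite normr0.
rewrite normrM (ger0_norm (expR_ge0 _)) expRN ler_pdivrMr ?expR_gt0//.
by apply: HC; rewrite invr_ge0 ltW.
Qed.

(** The exponential bound applied to ['X^2 * p] becomes quadratic decay at 0; this forces derivative
    0 at the junction point. *)
Lemma flat_sqr p : exists2 C, 0 <= C & forall t, `|flat p t| <= C * t ^+ 2.
Proof.
have [C C0 HC] := horner_le_expR ('X^2 * p); exists C => // t; rewrite /flat.
case: ifPn => [t0|_]; last by rewrite normr0 mulr_ge0// sqr_ge0.
rewrite normrM (ger0_norm (expR_ge0 _)) expRN ler_pdivrMr ?expR_gt0//.
have tV : 0 <= t^-1 by rewrite invr_ge0 ltW.
have := HC _ tV; rewrite hornerM hornerXn normrM (ger0_norm (exprn_ge0 _ tV)).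
by rewrite exprVn ler_pdivrMl ?exprn_gt0// mulrA [t ^+ 2 * C]mulrC.
Qed.

Definition dflat p : {poly R} := 'X^2 * (p - p^`()).

Lemma is_derive_flat p t : is_derive t 1 (flat p) (flat (dflat p) t).
Proof.
have [t0|t0|->] := ltgtP t 0.
- rewrite {2}/flat ltNge (ltW t0) /=.
  have H0 : is_derive t 1 (cst 0 : R -> R) 0 by exact: is_derive_cst.
  apply: near_eq_is_derive H0.
  have : \forall x \near t, x < 0 by exact: lt_nbhsl.
  by apply: filterS => x x0; rewrite /flat ltNge (ltW x0).
- have tn0 : t != 0 by rewrite gt_eqF.
  have iV : is_derive t 1 (fun y : R => y^-1) (- t ^- 2 *: 1).
    by apply: is_deriveV => //.
  have iN : is_derive t 1 (fun y : R => - y^-1) (- (- t ^- 2 *: 1)).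
    exact: is_deriveN.
  have H1 := is_derive1_comp (is_derive_poly p t^-1) iV.
  have H2 := @is_derive1_comp R expR (fun y : R => - y^-1) t _ _ (is_derive_expR _) iN.
  have H3 := is_deriveM H1 H2.
  have : \forall x \near t, 0 < x by exact: lt_nbhsr.
  move=> near0; apply: (near_eq_is_derive _ (is_derive_eq H3 _)).
    by apply: filterS near0 => x x0; rewrite /flat x0.
  rewrite {1}/flat t0 /dflat /= hornerM hornerXn hornerD hornerN.
  by rewrite /GRing.scale/= !mulr1 exprVn; ring.
- have [C C0 HC] := flat_sqr p.
  rewrite {2}/flat ltxx.
  have H : (fun h : R => h^-1 *: ((flat p \o shift 0) (h *: 1) - flat p 0)) @ 0^' --> (0 : R).
    apply/cvgrPdist_le => e e0.
    have d0 : 0 < e / (C + 1) by rewrite divr_gt0// ltr_wpDl.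
    near=> h.
    rewrite sub0r normrN /= addr0 {2}/flat ltxx subr0 /GRing.scale/= mulr1.
    have hn0 : h != 0 by near: h; exact: nbhs_dnbhs_neq.
    have hd : `|h| <= e / (C + 1).
      by near: h; apply: nbhs_dnbhs; apply: (@nbhs0_le _ R^o).
    rewrite normrM normfV ler_pdivrMl ?normr_gt0//.
    apply: le_trans (HC h) _; rewrite -real_normK ?num_real// expr2 mulrCA ler_wpM2l//.
    rewrite ler_pdivlMr ?ltr_wpDl// in hd.
    by have := normr_ge0 h; nra.
  by apply: DeriveDef; [apply/cvg_ex; exists 0|apply/cvg_lim].
Unshelve. all: by end_near. Qed.

Lemma is_derive_affine (a b t : R) : is_derive t 1 (fun h => a + h * b) b.
Proof.
have -> : (fun h => a + h * b) = cst a + b \*: id.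
  by apply/funext => h; rewrite /= mulrC.
by apply: is_derive_eq; rewrite add0r /GRing.scale/= mulr1.
Qed.

Lemma flat_ge0 t : 0 <= flat 1 t.
Proof. by rewrite /flat; case: ifP => // _; rewrite hornerC mul1r expR_ge0. Qed.

Lemma flat_neq0 t : flat 1 t != 0 -> 0 < t.
Proof. by rewrite /flat; case: ifP => // _; rewrite eqxx. Qed.

Lemma flat_lower t : 1 / 2 <= t -> expR (- 2) <= flat 1 t.
Proof.
move=> ht; have t0 : 0 < t by lra.
rewrite /flat t0 hornerC mul1r ler_expR lerN2.
by rewrite invf_ple ?posrE//; lra.
Qed.

End flat.

Section smooth_class.
Context (R : realType) (N : nat).
Local Notation V := 'rV[R]_N.

(** Every [smc] function is differentiable with [smc] directional derivatives,
    so smoothness in the sense of all iterated derivatives is one induction. *)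
Inductive smc : (V -> R) -> Prop :=
| smc_base p c d j : smc (fun x => flat p (c + d * x ord0 j))
| smc_cst a : smc (fun=> a)
| smcD f g : smc f -> smc g -> smc (fun x => f x + g x)
| smcM f g : smc f -> smc g -> smc (fun x => f x * g x).

Lemma smc_bounded f : smc f -> exists M, forall x, `|f x| <= M.
Proof.
elim=> [p c d j|a|{}f g _ [M HM] _ [M' HM']|{}f g _ [M HM] _ [M' HM']].
- by have [C HC] := flat_bounded p; exists C.
- by exists `|a|.
- by exists (M + M') => x; apply: le_trans (ler_normD _ _) _; exact: lerD.
- by exists (M * M') => x; rewrite normrM; apply: ler_pM.
Qed.

Lemma derive_lineE (f : V -> R) x v :
  'D_v f x = 'D_1 (fun h : R => f (h *: v + x)) 0.
Proof.
rewrite /derive; set g1 := (fun h => h^-1 *: _); set g2 := (fun h => h^-1 *: _).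
suff -> : g1 = g2 by [].
by rewrite funeqE /g1 /g2 => h /=; rewrite addr0 scale0r add0r [_%:A]mulr1.
Qed.

Lemma smc_base_derive p c d j x v :
  'D_v (fun x : V => flat p (c + d * x ord0 j)) x =
  flat (dflat p) (c + d * x ord0 j) * (d * v ord0 j).
Proof.
rewrite derive_lineE.
have -> : (fun h : R => flat p (c + d * (h *: v + x) ord0 j)) =
    flat p \o (fun h => (c + d * x ord0 j) + h * (d * v ord0 j)).
  by apply/funext => h /=; congr flat; rewrite !mxE; ring.
have H := @is_derive1_comp R (flat p) (fun h => (c + d * x ord0 j) + h * (d * v ord0 j)) 0 _ _
  (is_derive_flat p _) (is_derive_affine _ _ _).
by rewrite derive_val /= mul0r addr0.
Qed.

Lemma differentiable_coord_row (x : V) j : differentiable (fun y : V => y ord0 j : R) x.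
Proof. exact: differentiable_coord. Qed.

Lemma smc_differentiable f x : smc f -> differentiable f x.
Proof.
elim=> [p c d j|a|{}f g _ df _ dg|{}f g _ df _ dg].
- rewrite (_ : (fun x => _) = flat p \o (cst c + d \*: (fun y : V => y ord0 j : R))) //.
  apply: differentiable_comp.
    apply: differentiableD; first exact: differentiable_cst.
    by apply: differentiableZ; exact: differentiable_coord_row.
  apply/derivable1_diffP.
  exact: (@ex_derive _ _ _ _ _ _ _ (is_derive_flat p _)).
- exact: differentiable_cst.
- exact: differentiableD.
- exact: differentiableM.
Qed.

Lemma smc_derive f v : smc f -> smc (fun x => 'D_v f x).
Proof.
elim=> [p c d j|a|{}f g sf sdf sg sdg|{}f g sf sdf sg sdg].
- have -> : (fun x => 'D_v (fun x : V => flat p (c + d * x ord0 j)) x) =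
      fun x => flat (dflat p) (c + d * x ord0 j) * (d * v ord0 j).
    by apply/funext => x; exact: smc_base_derive.
  by apply: smcM; [exact: smc_base|exact: smc_cst].
- have -> : (fun x => 'D_v (fun=> a : R) x) = (fun=> 0 : R) :> (V -> R).
    by apply/funext => x; exact: derive_cst.
  exact: smc_cst.
- have -> : (fun x => 'D_v (fun x => f x + g x) x) = fun x => 'D_v f x + 'D_v g x.
    by apply/funext => x; apply: deriveD; apply: diff_derivable; exact: smc_differentiable.
  exact: smcD.
- have -> : (fun x => 'D_v (fun x => f x * g x) x) = fun x => f x * 'D_v g x + g x * 'D_v f x.
    by apply/funext => x; apply: deriveM; apply: diff_derivable; exact: smc_differentiable.
  by apply: smcD; exact: smcM.
Qed.

Lemma smc_smooth f : smc f -> smooth f.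
Proof.
move=> sf vs x; apply: smc_differentiable.
by elim: vs => //= v vs; exact: smc_derive.
Qed.

Lemma smc_prod n (F : 'I_n -> V -> R) : (forall i, smc (F i)) ->
  smc (fun x => \prod_(i < n) F i x).
Proof.
elim: n F => [F _|n IH F PF]; first by under eq_fun do rewrite big_ord0; exact: smc_cst.
under eq_fun do rewrite big_ord_recr.
by apply: smcM => //; exact: IH.
Qed.

Lemma smc_continuous f : smc f -> continuous f.
Proof. by move=> sf x; apply: differentiable_continuous; exact: smc_differentiable. Qed.

End smooth_class.

(** * Taylor expansion and symmetric second differences *)

Section taylor.
Context (R : realType) (N : nat).
Local Notation V := 'rV[R]_N.

(** Lagrange form of the remainder. [M] is chosen so that [K t = F t + (1 - t) F'(t) + (M / 2) (1 -
    t)^2] takes the same value at 0 and 1; since [K' = (1 - t) (F'' - M)], the mean value theorem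
    gives a point where [F'' = M]. *)
Lemma taylor2 (F dF ddF : R -> R) : (forall t : R, is_derive t 1 F (dF t)) ->
  (forall t : R, is_derive t 1 dF (ddF t)) ->
  exists c, 0 < c < 1 /\ F 1 = F 0 + dF 0 + ddF c / 2.
Proof.
move=> HF HdF; pose M := 2 * (F 1 - F 0 - dF 0).
pose o : R -> R := fun t => 1 - t.
have Ho (t : R) : is_derive t 1 o (-1).
  have := is_derive_affine 1 (-1) t.
  by rewrite (_ : (fun h => _) = o)//; apply/funext => h; rewrite mulrN1.
pose K := F + o * dF + (M / 2) \*: (o * o).
pose dK (t : R) := (1 - t) * (ddF t - M).
have HK (t : R) : is_derive t 1 K (dK t).
  have := is_deriveD (is_deriveD (HF t) (is_deriveM (Ho t) (HdF t)))
    (is_deriveZ (M / 2) (is_deriveM (Ho t) (Ho t))).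
  move=> H; apply: (is_derive_eq H).
  by rewrite /dK /o /GRing.scale/=; field.
have cK : {within `[0, 1], continuous K}.
  apply: continuous_subspaceT => t; apply: differentiable_continuous.
  by apply/derivable1_diffP; have [] := HK t.
have [c c01 E] := MVT (@ltr01 R) (fun t _ => HK t) cK.
exists c; move: c01; rewrite in_itv/= => /andP[c0 c1]; split; first by rewrite c0 c1.
have : K 1 - K 0 = 0.
  have KE t : K t = F t + (1 - t) * dF t + M / 2 * ((1 - t) * (1 - t)) by [].
  by rewrite !KE /M; field.
rewrite E /dK subr0 mulr1 => /eqP; rewrite mulf_eq0 subr_eq0 gt_eqF//= subr_eq0 => /eqP ->.
by rewrite /M; field.
Qed.

Lemma is_derive_line (f : V -> R) x z t : differentiable f (x + t *: z) ->
  is_derive t 1 (fun s : R => f (x + s *: z)) ('D_z f (x + t *: z)).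
Proof.
move=> df.
have E : (fun h : R => h^-1 *: (((fun s : R => f (x + s *: z)) \o shift t) (h *: 1) - f (x + t *: z)))
   = (fun h : R => h^-1 *: ((f \o shift (x + t *: z)) (h *: z) - f (x + t *: z))).
  apply/funext => h /=; congr (_ *: (f _ - _)).
  by rewrite [_%:A]mulr1 scalerDl addrCA addrC -addrA addrC.
apply: DeriveDef; last by rewrite /derive E.
by rewrite /derivable E; exact: diff_derivable.
Qed.

Lemma smc_deriveZ (f : V -> R) (c : R) (z x : V) : smc f -> 'D_(c *: z) f x = c * 'D_z f x.
Proof.
move=> sf; have df := smc_differentiable x sf.
by rewrite !deriveE// linearZ.
Qed.

Lemma smc_deriveE (f : V -> R) (z x : V) : smc f ->
  'D_z f x = \sum_(j < N) z ord0 j * 'D_(delta_mx ord0 j) f x.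
Proof.
move=> sf; have df := smc_differentiable x sf.
rewrite deriveE// {1}(row_sum_delta z) linear_sum; apply: eq_bigr => j _.
by rewrite linearZ deriveE.
Qed.

Lemma smc_taylor (f : V -> R) (x z : V) : smc f ->
  exists c, 0 < c < 1 /\
    f (x + z) = f x + 'D_z f x + 'D_z (fun y => 'D_z f y) (x + c *: z) / 2.
Proof.
move=> sf.
have H1 t := is_derive_line (smc_differentiable (x + t *: z) sf).
have H2 t := is_derive_line (smc_differentiable (x + t *: z) (smc_derive z sf)).
have [c [c01]] := taylor2 H1 H2.
by rewrite scale1r scale0r addr0 => E; exists c.
Qed.

Lemma enorm_ge0 (z : V) : 0 <= enorm z.
Proof. exact: sqrtr_ge0. Qed.

Lemma coord_le_enorm (z : V) j : `|z ord0 j| <= enorm z.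
Proof.
rewrite -sqrtr_sqr ler_wsqrtr// (bigD1 j)//= lerDl sumr_ge0// => i _.
exact: sqr_ge0.
Qed.

Lemma enormZ (c : R) (z : V) : enorm (c *: z) = `|c| * enorm z.
Proof.
rewrite /enorm -sqrtr_sqr -sqrtrM ?sqr_ge0// mulr_sumr; congr Num.sqrt.
by apply: eq_bigr => j _; rewrite mxE exprMn.
Qed.

Lemma enormN (z : V) : enorm (- z) = enorm z.
Proof. by rewrite -scaleN1r enormZ normrN normr1 mul1r. Qed.

(** In the standard basis this is a quadratic form in [z] whose coefficients, the second partial
    derivatives, are again in [smc] and hence bounded. *)
Lemma smc_second_bound (f : V -> R) : smc f ->
  exists2 C, 0 <= C & forall x z : V, `|'D_z (fun y => 'D_z f y) x| <= C * enorm z ^+ 2.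
Proof.
move=> sf.
have HB (p : 'I_N * 'I_N) : {M | forall x,
    `|'D_(delta_mx ord0 p.1) (fun y => 'D_(delta_mx ord0 p.2) f y) x| <= M}.
  by apply: cid; apply: smc_bounded; do 2 apply: smc_derive.
pose B i j := `|sval (HB (i, j))|.
exists (\sum_i \sum_j B i j) => [|x z].
  by do 2 apply: sumr_ge0 => ? _; exact: normr_ge0.
rewrite (smc_deriveE _ _ (smc_derive z sf)).
have E i : 'D_(delta_mx ord0 i) (fun y => 'D_z f y) x =
    \sum_(j < N) z ord0 j * 'D_(delta_mx ord0 i) (fun y => 'D_(delta_mx ord0 j) f y) x.
  rewrite (_ : (fun y => 'D_z f y) = \sum_(j < N) (z ord0 j \*: (fun y => 'D_(delta_mx ord0 j) f y))); last first.
    by apply/funext => y; rewrite fct_sumE; exact: smc_deriveE.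
  have dj (j : 'I_N) : derivable (fun y => 'D_(delta_mx ord0 j) f y) x (delta_mx ord0 i).
    by apply: diff_derivable; apply: smc_differentiable; exact: smc_derive.
  rewrite derive_sum; last by move=> j; exact: derivableZ.
  by apply: eq_bigr => j _; rewrite deriveZ.
under eq_bigr do rewrite E mulr_sumr.
apply: le_trans (ler_norm_sum _ _ _) _; rewrite mulr_suml; apply: ler_sum => i _.
apply: le_trans (ler_norm_sum _ _ _) _; rewrite mulr_suml; apply: ler_sum => j _.
rewrite mulrA normrM mulrC; apply: ler_pM => //.
  by rewrite /B; apply: le_trans (svalP (HB (i, j)) x) (ler_norm _).
by rewrite normrM expr2; apply: ler_pM => //; exact: coord_le_enorm.
Qed.

Definition sdiff (f : V -> R) (x z : V) : R := f (x + z) + f (x - z) - 2 * f x.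

Lemma smc_remainder (f : V -> R) : smc f -> exists2 C, 0 <= C & forall x z : V,
  `|f (x + z) - f x - 'D_z f x| <= C * enorm z ^+ 2.
Proof.
move=> sf; have [C C0 HC] := smc_second_bound sf; exists C => // x z.
have [c [_ ->]] := smc_taylor x z sf.
rewrite (_ : _ - _ = 'D_z (fun y => 'D_z f y) (x + c *: z) / 2); last by ring.
rewrite normrM [`|2^-1|]ger0_norm ?invr_ge0//.
by have := HC (x + c *: z) z; have := normr_ge0 ('D_z (fun y => 'D_z f y) (x + c *: z)); lra.
Qed.

(** The first-order terms at [z] and [- z] cancel, leaving two Taylor remainders. *)
Lemma smc_sdiff_bound (f : V -> R) : smc f ->
  exists2 C, 0 <= C & forall x z : V, `|sdiff f x z| <= C * enorm z ^+ 2.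
Proof.
move=> sf; have [C C0 HC] := smc_remainder sf; exists (2 * C) => [|x z].
  by rewrite mulr_ge0.
have DN : 'D_(- z) f x = - 'D_z f x by rewrite -scaleN1r smc_deriveZ// mulN1r.
have -> : sdiff f x z = (f (x + z) - f x - 'D_z f x) + (f (x - z) - f x - 'D_(- z) f x).
  by rewrite DN /sdiff; ring.
apply: le_trans (ler_normD _ _) _.
by have := HC x z; have := HC x (- z); rewrite enormN; lra.
Qed.

(** By Taylor, the rescaled difference is the mean of the second derivative at two intermediate
    points that tend to [x]. Thus the local part of the operator, like the nonlocal one, is reached
    through second differences. *)
Lemma smc_sdiff_cvg (f : V -> R) (x v : V) : smc f ->
  (fun k => k.+1%:R ^+ 2 * sdiff f x (k.+1%:R^-1 *: v)) @ \oo -->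
  'D_v (fun y => 'D_v f y) x.
Proof.
move=> sf.
pose G y := 'D_v (fun y => 'D_v f y) y.
have sG : smc G by do 2 apply: smc_derive.
have D2 (h : R) y : 'D_(h *: v) (fun y => 'D_(h *: v) f y) y = h ^+ 2 * G y.
  rewrite (_ : (fun y => 'D_(h *: v) f y) = h \*: (fun y => 'D_v f y)); last first.
    by apply/funext => y'; exact: smc_deriveZ.
  rewrite deriveZ; last by apply: diff_derivable; apply: smc_differentiable; exact: smc_derive.
  by rewrite (smc_deriveZ _ _ _ (smc_derive v sf)) /GRing.scale/= mulrA -expr2.
have /choice[c Hc] : forall k : nat, exists c : R * R,
    (0 < c.1 < 1) && (0 < c.2 < 1) /\ k.+1%:R ^+ 2 * sdiff f x (k.+1%:R^-1 *: v) =
      (G (x + (c.1 / k.+1%:R) *: v) + G (x - (c.2 / k.+1%:R) *: v)) / 2.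
  move=> k; set h := k.+1%:R^-1 : R.
  have [c1 [c1b E1]] := smc_taylor x (h *: v) sf.
  have [c2 [c2b E2]] := smc_taylor x ((- h) *: v) sf.
  exists (c1, c2); split=> /=; first by rewrite c1b c2b.
  rewrite /sdiff -scaleNr E1 E2 !D2 (smc_deriveZ h)// (smc_deriveZ (- h))//.
  rewrite !scalerA mulrN scaleNr sqrrN /h.
  have n0 : k.+1%:R != 0 :> R by rewrite pnatr_eq0.
  move: (G (x + _)) (G (x - _)) ('D_v f x) (f x) => a b d e.
  by move: (k.+1%:R : R) n0 => n n0; field.
have inv0 : (fun k => k.+1%:R^-1 : R) @ \oo --> (0 : R) by exact: cvg_harmonic.
have c0 (s : nat -> R) : (forall k, 0 < s k < 1) -> (fun k => s k / k.+1%:R) @ \oo --> (0 : R).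
  move=> sb; apply: (squeeze_cvgr _ (cvg_cst 0) inv0).
  apply: nearW => k; have /andP[s0 s1] := sb k.
  by rewrite mulr_ge0 ?invr_ge0 ?(ltW s0)//= ler_piMl ?invr_ge0// ltW.
have Gc (s : nat -> R) : s @ \oo --> (0 : R) -> (fun k => G (x + s k *: v)) @ \oo --> G x.
  move=> s0.
  have Hx : (fun k => x + s k *: v) @ \oo --> x.
    rewrite -[X in _ --> X]addr0 -(scale0r v).
    by apply: cvgD; [exact: cvg_cst|apply: cvgZr_tmp; exact: s0].
  by apply: continuous_cvg; [exact: smc_continuous|exact: Hx].
under eq_fun do rewrite (Hc _).2.
rewrite (_ : 'D_v _ x = (G x + G x) / 2); last by rewrite /G; field.
apply: cvgM; last exact: cvg_cst.
apply: cvgD.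
  by apply: Gc; apply: (c0 (fun k => (c k).1)) => k; have /andP[] := (Hc k).1.
under eq_fun do rewrite -scaleNr.
apply: Gc; rewrite -oppr0; apply: cvgN.
by apply: (c0 (fun k => (c k).2)) => k; have /andP[] := (Hc k).1.
Qed.

End taylor.

(** * Mollifiers that are test functions *)

Section bump.
Context (R : realType) (N : nat).
Local Notation V := 'rV[R]_N.
Variable k : R.
Hypothesis k0 : 0 < k.

(** A product over coordinates rather than a radial profile, so that it is built from the generators
    of [smc]. It lives in the cube of half-side [1/k]. *)
Definition bump (x : V) : R :=
  \prod_(j < N) (flat 1 (1 + k * x ord0 j) * flat 1 (1 - k * x ord0 j)).

Lemma bump_ge0 x : 0 <= bump x.
Proof. by apply: prodr_ge0 => j _; rewrite mulr_ge0// flat_ge0. Qed.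

Lemma bumpN x : bump (- x) = bump x.
Proof. by apply: eq_bigr => j _; rewrite mxE mulrN opprK mulrC. Qed.

Lemma bump_supp x : bump x != 0 -> forall j, `|x ord0 j| < k^-1.
Proof.
move=> + j; rewrite /bump (bigD1 j)//= mulf_eq0 negb_or => /andP[+ _].
rewrite mulf_eq0 negb_or => /andP[/flat_neq0 h1 /flat_neq0 h2].
by rewrite -[ltRHS]mul1r ltr_pdivlMr// -[X in _ * X]gtr0_norm// -normrM ltr_norml; lra.
Qed.

(** On the cube of half the size both arguments of [flat] are at least [1/2], so each factor is at
    least [expR (- 2)]. This gives a positive integral, by which the mollifier is normalised. *)
Lemma bump_lower (x : V) : (forall j, `|x ord0 j| <= (2 * k)^-1) ->
  (expR (- 2) * expR (- 2)) ^+ N <= bump x.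
Proof.
move=> hx; rewrite -[X in _ ^+ X]card_ord -prodr_const.
apply: ler_prod => j _; rewrite mulr_ge0 ?expR_ge0//=.
have : `|k * x ord0 j| <= 1 / 2.
  rewrite normrM (gtr0_norm k0) -ler_pdivlMl//.
  by apply: le_trans (hx j) _; rewrite invfM mul1r mulrC.
rewrite ler_norml => /andP[h1 h2].
by apply: ler_pM; rewrite ?expR_ge0//; apply: flat_lower; lra.
Qed.

Lemma smc_bump_shift (x : V) : smc (fun y => bump (x - y)).
Proof.
apply: smc_prod => j.
rewrite (_ : (fun _ => _) = fun y : V => flat 1 ((1 + k * x ord0 j) + (- k) * y ord0 j) *
   flat 1 ((1 - k * x ord0 j) + k * y ord0 j)).
  by apply: smcM; exact: smc_base.
by apply/funext => y; rewrite !mxE; congr (flat _ _ * flat _ _); ring.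
Qed.

Lemma smc_bump : smc bump.
Proof.
have := smc_bump_shift 0; congr smc; apply/funext => y.
by rewrite sub0r bumpN.
Qed.

End bump.

Section bump_kernel.
Context (R : realType) (N : nat).
Variable (lam : {measure set (RN R N) -> \bar R}).
Hypothesis L : is_lebesgue lam.
Local Notation V := (RN R N).

Lemma cbox_lty (a b : 'rV[R]_N) : (lam (cbox a b) < +oo)%E.
Proof.
have [ab|] := pselect (forall j, a ord0 j <= b ord0 j).
  by rewrite /cbox L// ltry.
move/existsNP => [j /negP]; rewrite -ltNge => baj.
suff -> : cbox a b = set0 by rewrite measure0.
by apply/seteqP; split=> // x /(_ j) /andP[h1 h2]; have := le_trans h1 h2; rewrite leNgt baj.
Qed.

Lemma Int_cbox (a b : 'rV[R]_N) : Int lam (\1_(cbox a b) : V -> R).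
Proof. by apply: Int_indic; [exact: measurable_cbox|exact: cbox_lty]. Qed.

Lemma Int_supp (f : V -> R) (M : R) (a b : 'rV[R]_N) : measurable_fun setT f ->
  (forall x, `|f x| <= M) -> (forall x, f x != 0 -> cbox a b x) -> Int lam f.
Proof.
move=> mf fM fs; apply: (Int_le (g := fun x => M * \1_(cbox a b) x)) => //.
  move=> x; rewrite indicE; have [->|fx] := eqVneq (f x) 0.
    by rewrite normr0 mulr_ge0//; exact: le_trans (normr_ge0 _) (fM x).
  by rewrite mem_set ?mulr1//; exact: fs.
by apply: IntZ; exact: Int_cbox.
Qed.

Variable k : R.
Hypothesis k0 : 0 < k.

Lemma measurable_bump : measurable_fun setT (@bump R N k : V -> R).
Proof. by apply: measurable_continuousRN; apply: smc_continuous; exact: smc_bump. Qed.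

Lemma bump_supp_cbox (x : V) : bump k x != 0 -> cbox (\row_j - k^-1) (\row_j k^-1) x.
Proof. by move=> /(bump_supp k0) h j; rewrite !mxE -ler_norml ltW. Qed.

Lemma Int_bump : Int lam (@bump R N k : V -> R).
Proof.
have [M HM] := smc_bounded (@smc_bump R N k).
by apply: Int_supp measurable_bump HM _ => x; exact: bump_supp_cbox.
Qed.

Lemma Rint_bump_gt0 : 0 < \int[lam]_x bump k x.
Proof.
pose c : R := (expR (- 2) * expR (- 2)) ^+ N.
have c0 : 0 < c by rewrite exprn_gt0// mulr_gt0// expR_gt0.
pose h := (2 * k)^-1; have h0 : 0 < h by rewrite invr_gt0 mulr_gt0.
pose B : set V := cbox (\row_j - h) (\row_j h).
apply: (@lt_le_trans _ _ (\int[lam]_x (c * \1_B x))); last first.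
  apply: Rint_le; [by apply: IntZ; exact: Int_cbox|exact: Int_bump|move=> x].
  rewrite indicE; have [Bx|nBx] := pselect (B x); last by rewrite memNset// mulr0 bump_ge0.
  rewrite mem_set// mulr1; apply: bump_lower => // j.
  by have := Bx j; rewrite !mxE -ler_norml.
rewrite RintZ; last exact: Int_cbox.
rewrite mulr_gt0// /Rintegral integral_indic//; last exact: measurable_cbox.
rewrite setIT /B /cbox L => [|j]; last by rewrite !mxE; lra.
by rewrite /=; apply: prodr_gt0 => j _; rewrite !mxE; lra.
Qed.

Definition mollifier (x : V) : R := (\int[lam]_y bump k y)^-1 * bump k x.

Lemma mollifier_kernel : is_kernel lam mollifier.
Proof.
have I0 := Rint_bump_gt0.
have [M HM] := smc_bounded (@smc_bump R N k).
split.
- by apply: measurable_funM => //; exact: measurable_bump.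
- by move=> x; rewrite mulr_ge0 ?bump_ge0// invr_ge0 ltW.
- exists ((\int[lam]_y bump k y)^-1 * M) => x; apply: ler_wpM2l; first by rewrite invr_ge0 ltW.
  exact: le_trans (ler_norm _) (HM x).
- by apply: IntZ; exact: Int_bump.
- by rewrite RintZ ?mulVf ?gt_eqF//; exact: Int_bump.
- by move=> x; rewrite /mollifier bumpN.
Qed.

Lemma smc_mollifier_shift (x : 'rV[R]_N) : smc (fun y : 'rV[R]_N => mollifier (x - y)).
Proof. by apply: smcM; [exact: smc_cst|exact: smc_bump_shift]. Qed.

Lemma smc_mollifier : smc (mollifier : 'rV[R]_N -> R).
Proof. by apply: smcM; [exact: smc_cst|exact: smc_bump]. Qed.

Lemma mollifier_supp (x : V) : mollifier x != 0 -> forall j, `|(x : 'rV[R]_N) ord0 j| < k^-1.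
Proof. by rewrite mulf_eq0 negb_or => /andP[_]; exact: bump_supp. Qed.

Lemma mollifier_test_fun (x : 'rV[R]_N) : test_fun (fun y : 'rV[R]_N => mollifier (x - y)).
Proof.
split; first by apply: smc_smooth; exact: smc_mollifier_shift.
pose B := [set y : 'rV[R]_N | forall j, `[x ord0 j - k^-1, x ord0 j + k^-1]%classic (y ord0 j)].
have cB : compact B.
  by apply: (@rV_compact R N (fun j => `[x ord0 j - k^-1, x ord0 j + k^-1]%classic)) => j; exact: segment_compact.
apply: (subclosed_compact _ cB); first exact: closed_closure.
have clB : closed B by apply: compact_closed => //; exact: norm_hausdorff.
rewrite ((closure_id B).1 clB); apply: closureS.
move=> y /= /mollifier_supp h j; rewrite /= in_itv/=.
by have := h j; rewrite !mxE ltr_norml; lra.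
Qed.

End bump_kernel.

Lemma mollifier_concentrate (R : realType) (N : nat) (lam : {measure set (RN R N) -> \bar R})
    (U : set 'rV[R]_N) : open U -> U 0 ->
  \forall n \near \oo, forall x : 'rV[R]_N, mollifier lam n.+1%:R x != 0 -> U x.
Proof.
move=> oU U0.
have /nbhs_ballP[e /= e0 eU] : nbhs (0 : 'rV[R]_N) U by exact: open_nbhs_nbhs.
have H : (fun n => n.+1%:R^-1 : R) @ \oo --> (0 : R) by exact: cvg_harmonic.
apply: filterS (cvg0_le H e0) => n hn x.
have n0 : 0 < n.+1%:R :> R by [].
move=> /(mollifier_supp n0) hx; apply: eU; split=> // i j.
by rewrite [i]ord1 mxE /ball/= sub0r normrN; exact: lt_le_trans (hx j) hn.
Qed.

(** * The Lévy operator as an integral of second differences *)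

Section levy.
Context (R : realType) (N : nat).
Local Notation V := (RN R N).

Definition levy_weight (z : V) : R := Num.min (enorm (z : 'rV[R]_N) ^+ 2) 1.

Lemma levy_weight_ge0 z : 0 <= levy_weight z.
Proof. by rewrite le_min sqr_ge0 ler01. Qed.

Lemma levy_weight_le z : levy_weight z <= enorm (z : 'rV[R]_N) ^+ 2.
Proof. by rewrite ge_min lexx. Qed.

Lemma levy_weight_small (z : V) : enorm (z : 'rV[R]_N) <= 1 ->
  levy_weight z = enorm (z : 'rV[R]_N) ^+ 2.
Proof. by move=> z1; apply/min_idPl; rewrite exprn_ile1// enorm_ge0. Qed.

Lemma levy_weight_large (z : V) : 1 < enorm (z : 'rV[R]_N) -> levy_weight z = 1.
Proof. by move=> z1; apply/min_idPr; rewrite exprn_ege1// ltW. Qed.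

Lemma enorm0 : enorm (0 : 'rV[R]_N) = 0.
Proof. by rewrite -(scale0r 0) enormZ normr0 mul0r. Qed.

Lemma levy_weight0 : levy_weight (0 : 'rV[R]_N) = 0.
Proof. by rewrite levy_weight_small enorm0 ?ler01// expr0n. Qed.

Lemma measurable_levy_weight : measurable_fun setT levy_weight.
Proof.
by apply: measurable_minr => //; apply: measurable_funX; exact: measurable_enorm.
Qed.

Variable (mu : {measure set V -> \bar R}).
Hypothesis Hmu0 : mu [set ((0%R : 'rV[R]_N) : V)] = 0%E.
Hypothesis Hmusym : forall A : set V, measurable A ->
  mu [set - x | x in A] = mu A.
Hypothesis Hmulevy : (\int[mu]_(z in [set~ ((0%R : 'rV[R]_N) : V)])
  (Num.min (enorm (z : 'rV[R]_N) ^+ 2) 1)%:E < +oo)%E.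

(** The integrands of interest vanish at the origin, so integrals against [mu] can be taken over the
    whole space, where Fubini and the change of variables are stated. *)
Lemma integral_setC0 (f : V -> R) : f (0 : 'rV[R]_N) = 0 ->
  (\int[mu]_(z in [set~ ((0%R : 'rV[R]_N) : V)]) (f z)%:E = \int[mu]_z (f z)%:E)%E.
Proof.
move=> f0; rewrite integral_mkcond; apply: eq_integral => z _; rewrite patchE.
case: ifPn => // /negP; rewrite inE /= => /contrapT ->; by rewrite f0.
Qed.

Lemma Int_levy_weight : Int mu levy_weight.
Proof.
apply: Int_ge0P; [exact: measurable_levy_weight|exact: levy_weight_ge0|].
by rewrite -integral_setC0 ?levy_weight0.
Qed.

(** Markov's inequality bounds the measure of the sets where the weight is at least [1/n]. They
    exhaust the complement of the origin, which is itself a null set. *)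
Lemma levy_sigma_finite : sigma_finite setT mu.
Proof.
pose A n : set V := [set z | 1 <= n%:R * levy_weight z].
have mA n : measurable (A n).
  rewrite -[A n]setTI (_ : A n = (fun z => n%:R * levy_weight z) @^-1` `[1, +oo[%classic).
    by apply: measurable_funM => //; exact: measurable_levy_weight.
  by apply/seteqP; split=> z; rewrite /A /= in_itv/= andbT.
have m0 : measurable [set ((0%R : 'rV[R]_N) : V)].
  rewrite (_ : [set _] = cbox 0 0); first exact: measurable_cbox.
  apply/seteqP; split=> [z -> j|z h]; first by rewrite mxE lexx.
  apply/rowP => j; rewrite mxE; apply/eqP; rewrite eq_le.
  by have := h j; rewrite mxE andbC.
exists (fun n => [set ((0%R : 'rV[R]_N) : V)] `|` A n).
  apply/seteqP; split=> // z _.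
  have [->|z0] := eqVneq z (0 : 'rV[R]_N); first by exists 0%N => //; left.
  have w0 : 0 < levy_weight z.
    rewrite lt_min ltr01 andbT exprn_gt0// lt_neqAle enorm_ge0 andbT eq_sym.
    apply: contra z0 => /eqP ez; apply/eqP/rowP => j; rewrite mxE; apply/eqP.
    by rewrite -normr_le0 -ez coord_le_enorm.
  exists (Num.truncn (levy_weight z)^-1).+1 => //; right.
  by rewrite /A /= -ler_pdivrMr// mul1r ltW// truncnS_gt.
move=> n; split; first exact: measurableU.
apply: (@le_lt_trans _ _ (mu [set ((0%R : 'rV[R]_N) : V)] + mu (A n))%E).
  exact: measureU2.
rewrite Hmu0 add0e -[A n]setIT -integral_indic//.
have IA := IntZ n%:R Int_levy_weight.
apply: le_lt_trans (integrable_lty measurableT IA).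
apply: ge0_le_integral => //.
- by apply/measurable_EFinP; exact: measurable_indic.
- by apply/measurable_EFinP; exact: Int_measurable IA.
- move=> z _; rewrite lee_fin indicE; have [Az|nAz] := pselect (A n z).
    by rewrite mem_set.
  by rewrite memNset// mulr_ge0// levy_weight_ge0.
Qed.

Lemma measurable_opp : measurable_fun setT (fun z : V => - (z : 'rV[R]_N) : V).
Proof.
under eq_fun do rewrite -scaleN1r.
by apply: measurable_funZRN.
Qed.

Lemma levy_opp (A : set V) : measurable A ->
  mu ((fun z : V => - (z : 'rV[R]_N) : V) @^-1` A) = mu A.
Proof.
move=> mA; rewrite -[RHS]Hmusym//; congr (mu _).
apply/seteqP; split=> [z /= Az|_ [z Az <-]]; last by rewrite /= opprK.
by exists (- (z : 'rV[R]_N)); rewrite ?opprK.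
Qed.

(** Taylor for [|z| <= 1] and the crude bound [4 M] beyond. *)
Lemma sdiff_weight (f : 'rV[R]_N -> R) : smc f ->
  exists2 C, 0 <= C & forall x z, `|sdiff f x z| <= C * levy_weight z.
Proof.
move=> sf; have [C C0 HC] := smc_sdiff_bound sf; have [M HM] := smc_bounded sf.
have M0 : 0 <= M by exact: le_trans (normr_ge0 _) (HM 0).
exists (C + 4 * M) => [|x z]; first by rewrite addr_ge0// mulr_ge0.
have [z1|z1] := leP (enorm z) 1.
  rewrite levy_weight_small//; apply: le_trans (HC x z) _.
  by apply: ler_wpM2r; [exact: sqr_ge0|rewrite lerDl mulr_ge0].
rewrite levy_weight_large// mulr1; apply: (@le_trans _ _ (4 * M)); last by rewrite lerDr.
have := HM (x + z); have := HM (x - z); have := HM x.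
by rewrite /sdiff !ler_norml; lra.
Qed.

Lemma measurable_sdiff (f : 'rV[R]_N -> R) (x : 'rV[R]_N) :
  measurable_fun [set: V] (f : V -> R) ->
  measurable_fun [set: V] (sdiff f x : V -> R).
Proof.
move=> mf; apply: measurable_funB => //; apply: measurable_funD.
- by apply: (measurableT_comp mf); apply: measurable_funDRN => //; exact: measurable_cst.
- by apply: (measurableT_comp mf); apply: measurable_funBRN => //; exact: measurable_cst.
Qed.

(** By symmetry of [mu] the integrand may be averaged with its reflection in [z]; the gradient
    compensator is odd and cancels, leaving half the second difference. *)
Lemma Lmu_sdiff (f : 'rV[R]_N -> R) (x : 'rV[R]_N) : smc f ->
  Int mu (sdiff f x : V -> R) /\ Lmu mu f x = 2^-1 * \int[mu]_z sdiff f x z.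
Proof.
move=> sf; have cf := smc_continuous sf.
have mf : measurable_fun [set: V] (f : V -> R) by exact: measurable_continuousRN.
have [C C0 HC] := sdiff_weight sf.
have Is : Int mu (sdiff f x : V -> R).
  by apply: Int_le (IntZ C Int_levy_weight) => //; exact: measurable_sdiff.
split=> //.
pose h (z : V) := f (x + z) - f x - (if enorm (z : 'rV[R]_N) <= 1 then 'd f x (z : 'rV[R]_N) else 0).
have dE z : 'd f x z = 'D_z f x by rewrite deriveE//; exact: smc_differentiable.
have mh : measurable_fun [set: V] h.
  apply: measurable_funB.
    apply: measurable_funB => //; apply: (measurableT_comp mf).
    by apply: measurable_funDRN => //; exact: measurable_cst.
  apply: measurable_fun_ifT => //.
    rewrite (_ : (fun _ => _) = (fun t : R => t <= 1) \o (@enorm R N : V -> R))//.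
    apply: measurableT_comp; last exact: measurable_enorm.
    by apply: measurable_fun_ler => //; exact: measurable_cst.
  (* The differential at a fixed point is linear in [z], so written in coordinates it is a Borel
     function. *)
  apply: (eq_measurable_fun (fun z : V =>
      \sum_(j < N) (z : 'rV[R]_N) ord0 j * 'D_(delta_mx ord0 j) f x)).
    by move=> z _; rewrite dE -smc_deriveE.
  apply: measurable_sum => j; apply: measurable_funM => //.
  exact: measurable_coordRN.
have Ih : Int mu h.
  have [C' C'0 HC'] := smc_remainder sf; have [M HM] := smc_bounded sf.
  have M0 : 0 <= M by exact: le_trans (normr_ge0 _) (HM 0).
  apply: Int_le (IntZ (C' + 2 * M) Int_levy_weight) => // z; rewrite /h dE.
  case: ifPn => [z1|]; last rewrite -ltNge => z1.
    rewrite levy_weight_small//; apply: le_trans (HC' x z) _.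
    by apply: ler_wpM2r; [exact: sqr_ge0|rewrite lerDl mulr_ge0].
  rewrite levy_weight_large// mulr1 subr0.
  apply: (@le_trans _ _ (2 * M)); last by rewrite lerDr.
  by have := HM (x + z); have := HM x; rewrite !ler_norml; lra.
have Iho := preserving_Int measurable_opp levy_opp Ih.
have -> : Lmu mu f x = \int[mu]_z h z.
  rewrite /Lmu /Rintegral; congr fine.
  apply: (integral_setC0 (f := h)).
  by rewrite /h addr0 subrr enorm0 ler01 linear0 subr0.
have -> : \int[mu]_z sdiff f x z = \int[mu]_z (h z + h (- (z : 'rV[R]_N))).
  apply: eq_Rintegral => z _; rewrite /h /sdiff enormN !dE.
  rewrite -scaleN1r (smc_deriveZ _ _ _ sf) scaleN1r.
  by case: ifP => _; ring.
by rewrite RintD// (preserving_Rint measurable_opp levy_opp Ih); field.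
Qed.

End levy.

(** * Dissipativity *)

Section dissipativity.
Context (R : realType) (N : nat).
Variable (lam : {measure set (RN R N) -> \bar R}).
Hypothesis L : is_lebesgue lam.
Local Notation V := (RN R N).

Lemma sdiff_pairing_le0 (T : R -> R) (u : V -> R) (M : R) (z : V) :
  {homo T : s t / s <= t} -> measurable_fun setT u -> (forall x, `|u x| <= M) ->
  Int lam (fun x => T (u x)) ->
  \int[lam]_x (T (u x) * sdiff u x z) <= 0.
Proof.
move=> Tmono mu uM IT.
pose a x := T (u x).
have Ish (h : V) : Int lam (fun x : V => a ((x : 'rV[R]_N) + h)) by exact: (Int_shift L h IT).
have mush (h : V) : measurable_fun setT (fun x : V => u ((x : 'rV[R]_N) + h)).
  exact: (measurableT_comp mu (measurable_shift h)).
have Iau (h h' : V) : Int lam (fun x : V => u ((x : 'rV[R]_N) + h) * a ((x : 'rV[R]_N) + h')).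
  by apply: (IntM (M := M)) => // x; exact: uM.
pose F1 (x : V) := a x * (u ((x : 'rV[R]_N) + z) - u x).
pose F2 (x : V) := a x * (u ((x : 'rV[R]_N) - z) - u x).
pose F3 (x : V) := a ((x : 'rV[R]_N) + z) * (u x - u ((x : 'rV[R]_N) + z)).
have I1 : Int lam F1.
  have := IntB (Iau z 0) (Iau 0 0); congr (_.-integrable _ _).
  by apply/funext => x; rewrite /F1 !addr0; congr (_%:E); ring.
have I2 : Int lam F2.
  have := IntB (Iau (- (z : 'rV[R]_N)) 0) (Iau 0 0); congr (_.-integrable _ _).
  by apply/funext => x; rewrite /F2 !addr0; congr (_%:E); ring.
have I3 : Int lam F3.
  have := IntB (Iau 0 z) (Iau z z); congr (_.-integrable _ _).
  by apply/funext => x; rewrite /F3 !addr0; congr (_%:E); ring.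
have -> : \int[lam]_x (T (u x) * sdiff u x z) = \int[lam]_x (F1 x + F2 x).
  by apply: eq_Rintegral => x _; rewrite /F1 /F2 /sdiff /a; ring.
(* Translating by [z] bases the backward difference at [x + z], so that it combines with the forward
   one into a product of two increments of equal sign, up to a minus. *)
have E23 : \int[lam]_x F2 x = \int[lam]_x F3 x.
  rewrite -(Rint_shift L z I2); apply: eq_Rintegral => x _.
  by rewrite /F2 /F3 addrK.
rewrite RintD// E23 -RintD//.
have <- : \int[lam]_x (0 : R) = 0 by rewrite Rintegral_cst// mul0r.
apply: Rint_le; [exact: IntD|exact: integrable0|move=> x].
rewrite /F1 /F3 /a.
have -> : T (u x) * (u ((x : 'rV[R]_N) + z) - u x) +
   T (u ((x : 'rV[R]_N) + z)) * (u x - u ((x : 'rV[R]_N) + z)) =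
   - ((T (u ((x : 'rV[R]_N) + z)) - T (u x)) * (u ((x : 'rV[R]_N) + z) - u x)) by ring.
rewrite oppr_le0; have [ux|/ltW ux] := leP (u x) (u ((x : 'rV[R]_N) + z)).
  by apply: mulr_ge0; rewrite subr_ge0// Tmono.
by apply: mulr_le0; rewrite subr_le0// Tmono.
Qed.

Variable (mu : {measure set V -> \bar R}).
Hypothesis Hmu0 : mu [set ((0%R : 'rV[R]_N) : V)] = 0%E.
Hypothesis Hmusym : forall A : set V, measurable A -> mu [set - x | x in A] = mu A.
Hypothesis Hmulevy : (\int[mu]_(z in [set~ ((0%R : 'rV[R]_N) : V)])
  (Num.min (enorm (z : 'rV[R]_N) ^+ 2) 1)%:E < +oo)%E.

Section pairing.
Variables (T : R -> R) (u : V -> R) (M C : R).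
Hypotheses (Tmono : {homo T : s t / s <= t}) (mu_u : measurable_fun setT u)
  (uM : forall x, `|u x| <= M) (IT : Int lam (fun x => T (u x)))
  (C0 : 0 <= C) (uC : forall x z, `|sdiff u x z| <= C * levy_weight z).

(** The majorant [C * levy_weight z * |T (u x)|] is integrable in both variables, so Fubini reduces
    the sign to the one for each fixed [z]. *)
Lemma sdiff_pairing_mu :
  Int lam (fun x => T (u x) * \int[mu]_z sdiff u x z) /\
  \int[lam]_x (T (u x) * \int[mu]_z sdiff u x z) <= 0.
Proof.
have sl := lebesgue_sigma_finite L.
have sm := levy_sigma_finite Hmu0 Hmulevy.
have Iw := Int_levy_weight Hmulevy.
pose f (p : V * V) := T (u p.1) * sdiff u p.1 p.2.
have mT := Int_measurable IT.
have mf : measurable_fun setT f.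
  apply: measurable_funM; first exact: (measurableT_comp mT).
  apply: measurable_funB.
    apply: measurable_funD; apply: (measurableT_comp mu_u).
      exact: measurable_funDRN.
    exact: measurable_funBRN.
  by apply: measurable_funM => //; apply: (measurableT_comp mu_u).
have Iz x : Int mu (fun z => sdiff u x z).
  by apply: Int_le (IntZ C Iw) => //; exact: measurable_sdiff.
have I2 x : Int mu (fun z => f (x, z)) by rewrite /f /=; exact: IntZ.
have I1 z : Int lam (fun x => f (x, z)).
  rewrite /f /=; under eq_fun do rewrite mulrC.
  apply: (IntM (M := C * levy_weight z)) => //.
  apply: measurable_funB.
    apply: measurable_funD; apply: (measurableT_comp mu_u).
      exact: measurable_shift.
    exact: (measurable_shift (- (z : 'rV[R]_N))).
  by apply: measurable_funM.
have Ih : Int lam (fun x => (C * \int[mu]_z levy_weight z) * `|T (u x)|).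
  by apply: IntZ; exact: Int_norm.
have [|H1 H2 E] := sf_fubini sl sm mf I2 I1 Ih.
  move=> x; rewrite /f /=; under eq_Rintegral do rewrite normrM.
  rewrite RintZ; last exact: Int_norm.
  rewrite mulrC ler_wpM2r// -RintZ//.
  apply: Rint_le; [exact: Int_norm|exact: IntZ|exact: uC].
have fE x : \int[mu]_z f (x, z) = T (u x) * \int[mu]_z sdiff u x z.
  by rewrite /f /= RintZ.
split.
  by have := H1; under eq_fun do rewrite fE.
under eq_Rintegral do rewrite -fE.
rewrite E; have <- : \int[mu]_z (0 : R) = 0 by rewrite Rintegral_cst// mul0r.
apply: Rint_le; [exact: H2|exact: integrable0|move=> z].
exact: sdiff_pairing_le0 uM IT.
Qed.

(** The rescaled differences stay below [C |v|^2] because the weight is at most the squared norm, so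
    dominated convergence with majorant [C |v|^2 |T (u x)|] passes the sign to the limit. *)
Lemma sdiff_pairing_lim (v : 'rV[R]_N) (G : V -> R) :
  (forall x, (fun k => k.+1%:R ^+ 2 * sdiff u x (k.+1%:R^-1 *: v)) @ \oo --> G x) ->
  Int lam (fun x => T (u x) * G x) /\ \int[lam]_x (T (u x) * G x) <= 0.
Proof.
move=> uG; have mT := Int_measurable IT.
have ms z : measurable_fun setT (fun x : V => sdiff u x z).
  apply: measurable_funB.
    apply: measurable_funD; apply: (measurableT_comp mu_u).
      exact: measurable_shift.
    exact: (measurable_shift (- (z : 'rV[R]_N))).
  by apply: measurable_funM.
have sC k x : `|k.+1%:R ^+ 2 * sdiff u x (k.+1%:R^-1 *: v)| <= C * enorm v ^+ 2.
  have n0 : (0 : R) < k.+1%:R by [].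
  rewrite normrM ger0_norm ?sqr_ge0// -ler_pdivlMl ?exprn_gt0//.
  apply: le_trans (uC _ _) _; rewrite mulrCA; apply: ler_wpM2l => //.
  apply: le_trans (levy_weight_le _) _.
  by rewrite enormZ exprMn ger0_norm ?invr_ge0// exprVn.
have IsT k : Int lam (fun x => T (u x) * sdiff u x (k.+1%:R^-1 *: v)).
  under eq_fun do rewrite mulrC.
  by apply: (IntM (M := C * levy_weight (k.+1%:R^-1 *: v))).
have [||||H1 H2] := @Rint_DCT _ V R lam
  (fun k x => T (u x) * (k.+1%:R ^+ 2 * sdiff u x (k.+1%:R^-1 *: v)))
  (fun x => T (u x) * G x) (fun x => (C * enorm v ^+ 2) * `|T (u x)|).
- by move=> k; apply: measurable_funM => //; apply: measurable_funM.
- by move=> x; apply: cvgM; [exact: cvg_cst|exact: uG].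
- by apply: IntZ; exact: Int_norm.
- by move=> k x; rewrite normrM mulrC; apply: ler_wpM2r.
split=> //; rewrite -(cvg_lim _ H2)//; apply: limr_le.
  by apply/cvg_ex; eexists; exact: H2.
apply: nearW => k; under eq_Rintegral do rewrite mulrCA.
rewrite RintZ//; apply: mulr_ge0_le0; first exact: sqr_ge0.
exact: sdiff_pairing_le0 uM IT.
Qed.

End pairing.

(** * Second differences of a mollified bounded function *)

Section mollified.
Variables (rho : V -> R) (r : R).
Hypotheses (K : is_kernel lam rho) (S : smc (rho : 'rV[R]_N -> R))
  (Sx : forall x : 'rV[R]_N, smc (fun y : 'rV[R]_N => rho (x - y)))
  (rho_supp : forall x : 'rV[R]_N, rho x != 0 -> forall j, `|x ord0 j| <= r).

Lemma sdiff_supp (x z : 'rV[R]_N) : sdiff rho x z != 0 ->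
  cbox (\row_j - (r + enorm z)) (\row_j (r + enorm z)) x.
Proof.
move=> + j; rewrite !mxE -ler_norml; apply: contraR; rewrite -ltNge => hj.
have s0 y : r < `|(y : 'rV[R]_N) ord0 j| -> rho y = 0.
  by move=> hy; apply/eqP; apply: contraLR hy => /rho_supp/(_ j); rewrite -leNgt.
have zj := coord_le_enorm z j; have e0 := enorm_ge0 z.
rewrite /sdiff (s0 x); last by lra.
rewrite (s0 (x + z)); last first.
  by rewrite mxE; apply: lt_le_trans (lerB_normD _ _); lra.
rewrite (s0 (x - z)); last first.
  by rewrite !mxE; apply: lt_le_trans (lerB_dist _ _); lra.
by rewrite addr0 mulr0 subrr.
Qed.

Lemma Int_sdiff_kernel (z : V) : Int lam (fun x => sdiff rho x z).
Proof.
apply: IntB; last by apply: IntZ; exact: kernel_integrable K.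
by apply: IntD; [exact: (Int_shift L z (kernel_integrable K))|exact: (Int_shift L (- (z : 'rV[R]_N)) (kernel_integrable K))].
Qed.

(** The estimate behind every interchange involving the merely bounded [Phi]. For [|z| <= 1] the
    second difference is of order [|z|^2] and lives in a fixed cube of volume [q]; for larger [z]
    the unit mass of the kernel gives [1 + 1 + 2 = 4]. *)
Lemma sdiff_kernel_L1 : exists2 C, 0 <= C &
  forall z : V, \int[lam]_x `|sdiff rho x z| <= C * levy_weight z.
Proof.
have [C C0 HC] := smc_sdiff_bound S.
pose Q : set V := cbox (\row_j - (r + 1)) (\row_j (r + 1)).
have IQ : Int lam (\1_Q : V -> R) by exact: Int_cbox.
pose q := \int[lam]_x (\1_Q : V -> R) x.
have q0 : 0 <= q by apply: Rintegral_ge0 => x _; rewrite indicE.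
exists (C * q + 4) => [|z]; first by rewrite addr_ge0// mulr_ge0.
have [z1|z1] := leP (enorm (z : 'rV[R]_N)) 1.
  rewrite levy_weight_small//.
  apply: (@le_trans _ _ (\int[lam]_x ((C * enorm (z : 'rV[R]_N) ^+ 2) * \1_Q x))).
    apply: Rint_le; [exact/Int_norm/Int_sdiff_kernel|exact: IntZ|move=> x].
    have [->|sne] := eqVneq (sdiff rho x z) 0.
      by rewrite normr0; apply: mulr_ge0; [exact: mulr_ge0 (sqr_ge0 _)|rewrite indicE].
    rewrite indicE mem_set ?mulr1; first exact: HC.
    by move=> j; have := sdiff_supp sne j; rewrite !mxE; lra.
  rewrite RintZ// -/q mulrAC; apply: ler_wpM2r; first exact: sqr_ge0.
  by rewrite lerDl.
rewrite levy_weight_large// mulr1.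
have Ir := kernel_integrable K; have Iz := Int_shift L z Ir.
have Iz' := Int_shift L (- (z : 'rV[R]_N)) Ir.
apply: (@le_trans _ _ 4); last by rewrite lerDr mulr_ge0.
have <- : \int[lam]_x (rho ((x : 'rV[R]_N) + z) + rho ((x : 'rV[R]_N) - z) + 2 * rho x) = 4.
  rewrite RintD; [|exact: IntD|exact: IntZ].
  rewrite RintD// RintZ// (Rint_shift L z Ir) (Rint_shift L (- (z : 'rV[R]_N)) Ir) (kernel_mass K).
  by ring.
apply: Rint_le; [exact/Int_norm/Int_sdiff_kernel|by apply: IntD; [exact: IntD|exact: IntZ]|move=> x].
have := kernel_ge0 K x; have := kernel_ge0 K ((x : 'rV[R]_N) + z); have := kernel_ge0 K ((x : 'rV[R]_N) - z).
by rewrite /sdiff ler_norml; lra.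
Qed.

Variables (Phi : V -> R) (M : R).
Hypotheses (mPhi : measurable_fun setT Phi) (PhiM : forall y, `|Phi y| <= M).

Let M0 : 0 <= M.
Proof. exact: le_trans (normr_ge0 _) (PhiM 0). Qed.

Lemma Int_sdiff_kernel_shift (x z : V) : Int lam (fun y : V => sdiff rho ((x : 'rV[R]_N) - y) z).
Proof. exact: (Int_reflect L x (Int_sdiff_kernel z)). Qed.

Lemma Int_Phi_sdiff (x z : V) :
  Int lam (fun y : V => Phi y * sdiff rho ((x : 'rV[R]_N) - y) z).
Proof. by apply: (IntM (M := M)) => //; exact: Int_sdiff_kernel_shift. Qed.

Lemma sdiff_shift (x y z : 'rV[R]_N) :
  sdiff (fun y : 'rV[R]_N => rho (x - y)) y z = sdiff rho (x - y) z.
Proof.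
rewrite /sdiff; congr (_ - _); rewrite addrC; congr (rho _ + rho _).
  by rewrite opprB addrCA addrC.
by rewrite opprD addrA.
Qed.

Lemma sdiff_convol (x z : V) :
  sdiff (convol lam rho Phi) x z = \int[lam]_y (Phi y * sdiff rho ((x : 'rV[R]_N) - y) z).
Proof.
have Ic x' := Int_convol_bounded L K x' mPhi PhiM.
rewrite /sdiff /convol -(RintZ 2 (Ic x)) -(RintD (Ic _) (Ic _)).
rewrite -(RintB (IntD (Ic _) (Ic _)) (IntZ 2 (Ic x))).
apply: eq_Rintegral => y _.
rewrite [(x : 'rV[R]_N) + z - y]addrAC [(x : 'rV[R]_N) - z - y]addrAC; ring.
Qed.

(** The differences fall on the kernel, so regularity of the mollified function comes from the L1
    bound on [rho] and the bound [M] on [Phi]. *)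
Lemma sdiff_convol_weight : exists2 C, 0 <= C &
  forall x z, `|sdiff (convol lam rho Phi) x z| <= C * levy_weight z.
Proof.
have [C C0 HC] := sdiff_kernel_L1; exists (M * C) => [|x z]; first exact: mulr_ge0.
rewrite sdiff_convol -mulrA.
apply: (@le_trans _ _ (M * \int[lam]_y `|sdiff rho ((x : 'rV[R]_N) - y) z|)).
  rewrite -RintZ; last exact/Int_norm/Int_sdiff_kernel_shift.
  apply: Rint_norm_le; [exact: Int_Phi_sdiff|exact/IntZ/Int_norm/Int_sdiff_kernel_shift|move=> y].
  by rewrite normrM; apply: ler_wpM2r.
apply: ler_wpM2l => //.
by rewrite (Rint_reflect L x (f := fun x => `|sdiff rho x z|)) //; exact/Int_norm/Int_sdiff_kernel.
Qed.

(** Dominated convergence on a fixed cube: all steps [v / (k + 1)] have norm at most [|v|], so the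
    differences of the kernel are supported within half-side [r + |v|]. The limit is what the weak
    equation contains for one column of [sigma]. *)
Lemma convol_second (x v : 'rV[R]_N) :
  let D y := 'D_v (fun y => 'D_v (fun y : 'rV[R]_N => rho (x - y)) y) y in
  Int lam (fun y : V => Phi y * D y) /\
  (fun k => k.+1%:R ^+ 2 * sdiff (convol lam rho Phi) x (k.+1%:R^-1 *: v)) @ \oo -->
    \int[lam]_y (Phi y * D y).
Proof.
move=> D; have [C C0 HC] := smc_sdiff_bound S.
pose s := r + enorm v.
pose Q : set V := cbox (\row_j - s) (\row_j s).
have IQ : Int lam (\1_Q : V -> R) by exact: Int_cbox.
have sQ k (y : 'rV[R]_N) : `|k.+1%:R ^+ 2 * sdiff rho y (k.+1%:R^-1 *: v)| <=
    C * enorm v ^+ 2 * \1_Q y.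
  have n0 : (0 : R) < k.+1%:R by [].
  have [->|sne] := eqVneq (sdiff rho y (k.+1%:R^-1 *: v)) 0.
    by rewrite mulr0 normr0; apply: mulr_ge0; [exact: mulr_ge0 (sqr_ge0 _)|rewrite indicE].
  have -> : \1_Q y = 1 :> R.
    rewrite indicE mem_set// => j.
    have := sdiff_supp sne j; rewrite !mxE /s enormZ ger0_norm ?invr_ge0//.
    have : k.+1%:R^-1 * enorm v <= enorm v.
      by rewrite ler_piMl ?enorm_ge0// invf_le1// ler1n.
    by move: (_ * enorm v) => t; lra.
  rewrite mulr1 normrM ger0_norm ?sqr_ge0// -ler_pdivlMl ?exprn_gt0//.
  apply: le_trans (HC _ _) _.
  by rewrite enormZ exprMn ger0_norm ?invr_ge0// exprVn [leLHS]mulrCA.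
have [||||H1 H2] := @Rint_DCT _ V R lam
  (fun k (y : V) => Phi y * (k.+1%:R ^+ 2 * sdiff rho (x - (y : 'rV[R]_N)) (k.+1%:R^-1 *: v)))
  (fun y => Phi y * D y) (fun y : V => M * (C * enorm v ^+ 2 * \1_Q (x - (y : 'rV[R]_N)))).
- move=> k; apply: measurable_funM => //; apply: measurable_funM => //.
  exact: Int_measurable (Int_sdiff_kernel_shift _ _).
- move=> y; apply: cvgM; first exact: cvg_cst.
  have := @smc_sdiff_cvg R N _ y v (Sx x).
  by under eq_fun do rewrite sdiff_shift.
- by apply: IntZ; apply: IntZ; exact: (Int_reflect L x IQ).
- by move=> k y; rewrite normrM; apply: ler_pM.
split=> //; rewrite (_ : (fun k => _) = fun k => \int[lam]_y
    (Phi y * (k.+1%:R ^+ 2 * sdiff rho (x - (y : 'rV[R]_N)) (k.+1%:R^-1 *: v)))) //.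
apply/funext => k; under [RHS]eq_Rintegral do rewrite mulrCA.
by rewrite RintZ ?sdiff_convol//; exact: Int_Phi_sdiff.
Qed.

(** Fubini in [y] and [z], justified by [sdiff_kernel_L1], moves the nonlocal operator from the test
    function onto the mollified [Phi]. *)
Lemma convol_Lmu (x : 'rV[R]_N) :
  let D y := Lmu mu (fun y : 'rV[R]_N => rho (x - y)) y in
  Int lam (fun y : V => Phi y * D y) /\
  \int[lam]_y (Phi y * D y) = 2^-1 * \int[mu]_z sdiff (convol lam rho Phi) x z.
Proof.
move=> D.
have sl := lebesgue_sigma_finite L.
have sm := levy_sigma_finite Hmu0 Hmulevy.
have Iw := Int_levy_weight Hmulevy.
have DE y : D y = 2^-1 * \int[mu]_z sdiff rho (x - y) z.
  rewrite /D; have [_ ->] := Lmu_sdiff Hmusym Hmulevy y (Sx x).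
  by congr (_ * _); apply: eq_Rintegral => z _; exact: sdiff_shift.
have Iz (y : 'rV[R]_N) : Int mu (fun z : V => sdiff rho (x - y) z).
  have [Iz _] := Lmu_sdiff Hmusym Hmulevy (x - y) S; exact: Iz.
have [C C0 HC] := sdiff_kernel_L1.
pose f (p : V * V) := Phi p.2 * sdiff rho (x - (p.2 : 'rV[R]_N)) p.1.
have mf : measurable_fun setT f.
  have m2 : measurable_fun setT (fun p : V * V => x - (p.2 : 'rV[R]_N) : V).
    by apply: measurable_funBRN => //; exact: measurable_cst.
  have mk := kernel_measurable K.
  apply: measurable_funM; first exact: (measurableT_comp mPhi).
  apply: measurable_funB.
    apply: measurable_funD; apply: (measurableT_comp mk).
      exact: measurable_funDRN.
    exact: measurable_funBRN.
  by apply: measurable_funM => //; apply: (measurableT_comp mk).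
have I2 z : Int lam (fun y => f (z, y)) by exact: Int_Phi_sdiff.
have I1 y : Int mu (fun z => f (z, y)) by rewrite /f /=; apply: IntZ; exact: Iz.
have Ih : Int mu (fun z => (M * C) * levy_weight z) by exact: IntZ.
have [|_ H2 E] := sf_fubini sm sl mf I2 I1 Ih.
  move=> z; rewrite -mulrA.
  apply: (@le_trans _ _ (M * \int[lam]_y `|sdiff rho (x - (y : 'rV[R]_N)) z|)).
    rewrite -RintZ; last exact/Int_norm/Int_sdiff_kernel_shift.
    apply: Rint_le; [exact: Int_norm|exact/IntZ/Int_norm/Int_sdiff_kernel_shift|move=> y].
    by rewrite normrM; apply: ler_wpM2r.
  apply: ler_wpM2l => //.
  by rewrite (Rint_reflect L x (f := fun x => `|sdiff rho x z|)) //; exact/Int_norm/Int_sdiff_kernel.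
have fE y : 2^-1 * \int[mu]_z f (z, y) = Phi y * D y.
  by rewrite DE mulrCA; congr (_ * _); rewrite /f /= RintZ//; exact: Iz.
split.
  by have := IntZ 2^-1 H2; under eq_fun do rewrite fE.
under eq_Rintegral do rewrite -fE.
rewrite RintZ// -E; congr (_ * _); apply: eq_Rintegral => z _.
by rewrite sdiff_convol.
Qed.

End mollified.
End dissipativity.

(** * The energy inequality *)

Section shrink.
Context (R : realType).

(** Soft thresholding: [sign(s) * max(|s| - eta, 0)] for [eta >= 0]. *)
Definition shrink (eta s : R) : R := Num.max (s - eta) 0 + Num.min (s + eta) 0.

Variable eta : R.
Hypothesis eta0 : 0 <= eta.

Lemma shrink_mono : {homo shrink eta : s t / s <= t}.
Proof.
move=> s t st; apply: lerD.
  by rewrite ge_max le_max lerD2r st /= le_max lexx orbT.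
by rewrite le_min ge_min lerD2r st /= ge_min lexx orbT.
Qed.

Lemma shrink_cases (s : R) : [\/ s <= - eta /\ shrink eta s = s + eta,
  (- eta <= s <= eta) /\ shrink eta s = 0 | eta <= s /\ shrink eta s = s - eta].
Proof.
have e0 := eta0; rewrite /shrink; have [h1|h1] := leP (s - eta) 0; have [h2|h2] := leP (s + eta) 0.
- by constructor 1; split; lra.
- by constructor 2; split; lra.
- by constructor 2; split; lra.
- by constructor 3; split; lra.
Qed.

Lemma shrink_le_norm (s : R) : `|shrink eta s| <= `|s|.
Proof.
have e0 := eta0; case: (shrink_cases s) => [[h ->]|[h ->]|[h ->]].
- by rewrite (ler0_norm (x := s)); [rewrite ler0_norm; lra|lra].
- by rewrite normr0.
- by rewrite (ger0_norm (x := s)); [rewrite ger0_norm; lra|lra].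
Qed.

(** The threshold absorbs exactly the additive error [eta] in [|Phi| <= eta + C |W|], leaving an
    integrable bound. *)
Lemma shrink_le (s c : R) : 0 <= c -> `|s| <= eta + c -> `|shrink eta s| <= c.
Proof.
move=> c0; have e0 := eta0; rewrite !ler_norml.
by case: (shrink_cases s) => [[h ->]|[h ->]|[h ->]]; lra.
Qed.

Lemma shrink_close (s : R) : `|s - shrink eta s| <= eta.
Proof.
by have e0 := eta0; rewrite !ler_norml; case: (shrink_cases s) => [[h ->]|[h ->]|[h ->]]; lra.
Qed.

Lemma measurable_shrink : measurable_fun setT (shrink eta).
Proof.
apply: measurable_funD.
  by apply: measurable_maxr => //; apply: measurable_funB.
by apply: measurable_minr => //; apply: measurable_funD.
Qed.

End shrink.

(** Heine-Cantor by compactness, with only [s] confined to the interval. Continuity at a centre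
    holds within radius [e]; half of it is spent on moving the centre to a nearby point, the other
    half on the distance to [t]. *)
Lemma continuous_modulus (R : realType) (phi : R -> R) (M eta : R) :
  continuous phi -> 0 < eta -> exists2 d, 0 < d &
  forall s t, - M <= s <= M -> `|s - t| <= d -> `|phi s - phi t| <= eta.
Proof.
move=> cphi eta0.
have /compact_near_coveringP := @segment_compact R (- M) M.
pose P (d s : R) := forall t, `|s - t| <= d -> `|phi s - phi t| <= eta.
move=> /(_ R (0^'+) P _) [].
  move=> s _.
  have e2 : 0 < eta / 2 by lra.
  have /cvgrPdist_le/(_ _ e2)/nbhs_ballP[e /= e0 He] := cphi s.
  exists (ball s (e / 2), [set d | d < e / 2]).
    split; first by apply: nbhsx_ballx; lra.
    by apply: nbhs_right_lt; lra.
  move=> [s' d] [/= hs hd] t ht.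
  have h1 : `|phi s - phi s'| <= eta / 2.
    by apply: He; move: hs; rewrite /ball/=; lra.
  have h2 : `|phi s - phi t| <= eta / 2.
    apply: He; move: hs ht; rewrite /ball/= !(ltr_norml, ler_norml); lra.
  by move: h1 h2; rewrite !ler_norml; lra.
(* The neighbourhood of [0^'+] supplies radii strictly between 0 and [d]; half of [d] is one of
   them. *)
move=> d /= d0 Hd; exists (d / 2); first lra.
move=> s t sM; apply: (Hd (d / 2)) => /=; rewrite ?in_itv//=; last lra.
by rewrite sub0r normrN ger0_norm; lra.
Qed.

(** * Testing the equation with mollifiers *)

Section core.
Context (R : realType) (N P : nat).
Variable (lam : {measure set (RN R N) -> \bar R}).
Hypothesis L : is_lebesgue lam.
Local Notation V := (RN R N).
Variable (sigma : 'M[R]_(N, P)).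
Variable (mu : {measure set V -> \bar R}).
Hypothesis Hmu0 : mu [set ((0%R : 'rV[R]_N) : V)] = 0%E.
Hypothesis Hmusym : forall A : set V, measurable A -> mu [set - x | x in A] = mu A.
Hypothesis Hmulevy : (\int[mu]_(z in [set~ ((0%R : 'rV[R]_N) : V)])
  (Num.min (enorm (z : 'rV[R]_N) ^+ 2) 1)%:E < +oo)%E.

Lemma Rint_sum (n : nat) (F : 'I_n -> V -> R) : (forall i, Int lam (F i)) ->
  Int lam (fun x => \sum_(i < n) F i x) /\
  \int[lam]_x (\sum_(i < n) F i x) = \sum_(i < n) \int[lam]_x F i x.
Proof.
elim: n F => [F _|n IH F IF].
  under eq_fun do rewrite big_ord0; under eq_Rintegral do rewrite big_ord0.
  by rewrite big_ord0 Rintegral_cst// mul0r; split=> //; exact: integrable0.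
have [I1 E1] := IH (fun i => F (widen_ord (leqnSn n) i)) (fun i => IF _).
split.
  by under eq_fun do rewrite big_ord_recr; exact: IntD.
under eq_Rintegral do rewrite big_ord_recr.
by rewrite RintD// E1 big_ord_recr.
Qed.

Section fixed_scale.
Variable k : R.
Hypothesis k0 : 0 < k.
Let rho : V -> R := mollifier lam k.
Let psi (x : 'rV[R]_N) (y : 'rV[R]_N) : R := rho (x - y).
Let K : is_kernel lam rho := mollifier_kernel L k0.
Let S : smc (rho : 'rV[R]_N -> R) := @smc_mollifier R N lam k.
Let Sx (x : 'rV[R]_N) : smc (psi x) := @smc_mollifier_shift R N lam k x.

Let supp (x : 'rV[R]_N) : rho x != 0 -> forall j, `|x ord0 j| <= k^-1.
Proof. by move=> /(mollifier_supp k0) h j; exact: ltW. Qed.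

Variables (Phi : V -> R) (M : R).
Hypotheses (mPhi : measurable_fun setT Phi) (PhiM : forall y, `|Phi y| <= M).

(** It serves for the composed solutions [phi (v1 y)] and [phi (v2 y)], and with the constant
    function 1 it yields measurability of the operator applied to the test function. *)
Lemma Int_Phi_Lop x : Int lam (fun y => Phi y * Lop sigma mu (psi x) y).
Proof.
have H i := (convol_second L K S Sx supp mPhi PhiM x (col i sigma)^T).1.
have [H1 _] := Rint_sum H.
have [H2 _] := convol_Lmu L Hmu0 Hmusym Hmulevy K S Sx supp mPhi PhiM x.
have := IntD H1 H2; congr (_.-integrable _ _); apply/funext => y.
by rewrite /Lop /Lsigma mulrDr mulr_sumr.
Qed.

(** The hypothesis on [W] is the weak equation tested with [psi x]. Rewritten through
    [convol_second] and [convol_Lmu], it splits the mollified [W] into one limit per column of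
    [sigma] and a nonlocal integral, each of which pairs with [T (u x)] to something nonpositive. *)
Lemma energy_le0 (T : R -> R) (W : V -> R) :
  {homo T : s t / s <= t} -> Int lam (fun x => T (convol lam rho Phi x)) ->
  (forall x, convol lam rho W x = \int[lam]_y (Phi y * Lop sigma mu (psi x) y)) ->
  \int[lam]_x (T (convol lam rho Phi x) * convol lam rho W x) <= 0.
Proof.
move=> Tmono IT WE.
pose u := convol lam rho Phi.
have mu_u : measurable_fun setT u by exact: convol_measurable PhiM.
have uM x : `|u x| <= M by exact: convol_bounded.
have [C C0 uC] := sdiff_convol_weight L K S supp mPhi PhiM.
have [I2 E2] := sdiff_pairing_mu L Hmu0 Hmulevy Tmono mu_u uM IT uC.
pose D i (x y : 'rV[R]_N) := 'D_((col i sigma)^T) (fun y => 'D_((col i sigma)^T) (psi x) y) y.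
have HD i x : Int lam (fun y : V => Phi y * D i x y) /\ _ :=
  convol_second L K S Sx supp mPhi PhiM x (col i sigma)^T.
pose G i x := \int[lam]_y (Phi y * D i x y).
have HG i := sdiff_pairing_lim L Tmono mu_u uM IT C0 uC (v := (col i sigma)^T)
  (fun x => (HD i x).2).
have gE x : convol lam rho W x = \sum_i G i x + 2^-1 * \int[mu]_z sdiff u x z.
  rewrite WE; have [H2 <-] := convol_Lmu L Hmu0 Hmusym Hmulevy K S Sx supp mPhi PhiM x.
  have [H1 E1] := Rint_sum (fun i => (HD i x).1).
  rewrite -E1 -RintD//; apply: eq_Rintegral => y _.
  by rewrite /Lop /Lsigma mulrDr mulr_sumr.
have [I1 E1] := Rint_sum (fun i => (HG i).1).
have -> : \int[lam]_x (T (u x) * convol lam rho W x) =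
  \int[lam]_x (\sum_i (T (u x) * G i x) + 2^-1 * (T (u x) * \int[mu]_z sdiff u x z)).
  by apply: eq_Rintegral => x _; rewrite gE mulrDr mulr_sumr mulrCA.
rewrite RintD//; last exact: IntZ.
have p1 : \int[lam]_x (\sum_i (T (u x) * G i x)) <= 0.
  by rewrite E1; apply: sumr_le0 => i _; exact: (HG i).2.
have p2 : 2^-1 * \int[lam]_x (T (u x) * \int[mu]_z sdiff u x z) <= 0.
  by apply: mulr_ge0_le0; [rewrite invr_ge0|exact: E2].
rewrite (RintZ _ I2); move: p1 p2; lra.
Qed.

Lemma mollified_pairing_le0 (W : V -> R) : Int lam W ->
  (forall eta, 0 < eta -> exists2 C, 0 <= C & forall y, `|Phi y| <= eta + C * `|W y|) ->
  (forall x, convol lam rho W x = \int[lam]_y (Phi y * Lop sigma mu (psi x) y)) ->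
  \int[lam]_x (convol lam rho Phi x * convol lam rho W x) <= 0.
Proof.
move=> IW PhiW WE; pose u := convol lam rho Phi; pose g := convol lam rho W.
have mu_u : measurable_fun setT u by exact: convol_measurable PhiM.
have uM x : `|u x| <= M by exact: convol_bounded.
have Ig : Int lam g by exact: (convol_integrable L K IW).1.
have Iga : Int lam (convol lam rho (fun y => `|W y|)) := (convol_integrable L K (Int_norm IW)).1.
have IT eta : 0 < eta -> Int lam (fun x => shrink eta (u x)).
  move=> eta0; have [C C0 HC] := PhiW eta eta0.
  apply: Int_le (IntZ C Iga) => [|x].
    exact: (measurableT_comp (measurable_shrink eta) mu_u).
  apply: shrink_le; first exact: ltW.
    apply: mulr_ge0 => //; apply: Rintegral_ge0 => y _.
    by rewrite mulr_ge0// (kernel_ge0 K).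
  have Ik := Int_kernel L K x; have IWk := Int_convol_integrable L K x (Int_norm IW).
  (* The kernel has mass 1, so the constant [eta] can be put under the convolution integral. *)
  have -> : eta + C * convol lam rho (fun y => `|W y|) x =
    \int[lam]_y (eta * rho ((x : 'rV[R]_N) - y) + C * (`|W y| * rho ((x : 'rV[R]_N) - y))).
    by rewrite (RintD (IntZ eta Ik) (IntZ C IWk)) (RintZ eta Ik) (RintZ C IWk) (Rint_kernel L K x) mulr1.
  apply: Rint_norm_le; first exact: Int_convol_bounded PhiM.
    by apply: IntD; exact: IntZ.
  move=> y; rewrite normrM (kernel_norm K).
  rewrite (_ : _ + _ = (eta + C * `|W y|) * rho ((x : 'rV[R]_N) - y)); last by ring.
  apply: ler_wpM2r => //.
  exact: kernel_ge0 K _.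
have [||||_ H] := @Rint_DCT _ V R lam (fun n x => shrink n.+1%:R^-1 (u x) * g x)
   (fun x => u x * g x) (fun x => M * `|g x|).
- move=> n; apply: measurable_funM; last exact: Int_measurable Ig.
  exact: (measurableT_comp (measurable_shrink _) mu_u).
- move=> x; apply: cvgM; last exact: cvg_cst.
  have inv0 : (fun k => k.+1%:R^-1 : R) @ \oo --> (0 : R) by exact: cvg_harmonic.
  apply/cvgrPdist_le => e e0; apply: filterS (cvg0_le inv0 e0) => n hn.
  by apply: le_trans hn; apply: shrink_close; rewrite invr_ge0.
- by apply: IntZ; exact: Int_norm.
- move=> n x; rewrite normrM; apply: ler_wpM2r => //.
  by apply: le_trans (uM x); apply: shrink_le_norm; rewrite invr_ge0.
rewrite -(cvg_lim _ H)//; apply: limr_le.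
  by apply/cvg_ex; eexists; exact: H.
apply: nearW => n; apply: energy_le0 => //; first by apply: shrink_mono.
by apply: IT; rewrite invr_gt0.
Qed.

End fixed_scale.

(** [Phi] need not be integrable, so the mollifier is made to act on [W] both times: replacing [W]
    by [g] against [Phi], using self-adjointness to read the result as the pairing of [u] with [W],
    and replacing [W] by [g] again. *)
Lemma pairing_le0 (Phi W : V -> R) (M : R) :
  measurable_fun setT Phi -> (forall y, `|Phi y| <= M) -> Int lam W ->
  (forall eta, 0 < eta -> exists2 C, 0 <= C & forall y, `|Phi y| <= eta + C * `|W y|) ->
  (forall n (x : V), convol lam (mollifier lam n.+1%:R) W x =
     \int[lam]_y (Phi y * Lop sigma mu (fun y : 'rV[R]_N => mollifier lam n.+1%:R ((x : 'rV[R]_N) - y)) y)) ->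
  \int[lam]_x (Phi x * W x) <= 0.
Proof.
move=> mPhi PhiM IW PhiW WE.
have M0 : 0 <= M by exact: le_trans (normr_ge0 _) (PhiM 0).
have K n : is_kernel lam (mollifier lam n.+1%:R) by apply: mollifier_kernel.
apply/ler_addgt0Pr => e e0; rewrite add0r.
(* Each of the two replacements of [W] by [g] costs [M] times the L1 error; the extra 1 keeps the
   denominator positive. *)
have e1 : 0 < e / (2 * M + 1) by rewrite divr_gt0// ltr_wpDl// mulr_ge0.
have [n _ /(_ n (leqnn n)) /= Hn] := cvg0_le (mollify_L1 L K (@mollifier_concentrate R N lam) IW) e1.
set u := convol lam (mollifier lam n.+1%:R) Phi; set g := convol lam (mollifier lam n.+1%:R) W in Hn.
have Ig : Int lam g by exact: (convol_integrable L (K n) IW).1.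
have mu_u : measurable_fun setT u by exact: convol_measurable PhiM.
have uM x : `|u x| <= M by exact: convol_bounded.
have IgW := IntB Ig IW.
have IPW : Int lam (fun x => Phi x * W x) by exact: (IntM (M := M)).
have IPg : Int lam (fun x => Phi x * g x) by exact: (IntM (M := M)).
have IuW : Int lam (fun x => u x * W x) by exact: (IntM (M := M)).
have Iug : Int lam (fun x => u x * g x) by exact: (IntM (M := M)).
have ug : \int[lam]_x (u x * g x) <= 0.
  exact: (mollified_pairing_le0 _ mPhi PhiM IW PhiW (WE n)).
have bd (a : V -> R) : measurable_fun setT a -> (forall x, `|a x| <= M) ->
    Int lam (fun x => a x * W x) -> Int lam (fun x => a x * g x) ->
    \int[lam]_x (a x * W x) <= \int[lam]_x (a x * g x) + M * \int[lam]_x `|g x - W x|.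
  move=> ma aM I1 I2; rewrite -RintZ; last exact: Int_norm.
  rewrite -RintD//; last by apply: IntZ; exact: Int_norm.
  apply: Rint_le => //; first by apply: IntD => //; apply: IntZ; exact: Int_norm.
  move=> x; rewrite -lerBlDl -mulrBr.
  apply: le_trans (ler_norm _) _; rewrite normrM distrC; exact: ler_wpM2r.
have h1 := bd _ mPhi PhiM IPW IPg; have h2 := bd _ mu_u uM IuW Iug.
rewrite (convol_adjoint L (K n) mPhi PhiM IW) -/g in h2.
set I := \int[lam]_x `|g x - W x| in Hn h1 h2.
rewrite ler_pdivlMr ?ltr_wpDl// ?mulr_ge0// in Hn.
have I0 : 0 <= I by apply: Rintegral_ge0.
have : I * (2 * M + 1) = 2 * (M * I) + I by ring.
lra.
Qed.

End core.

(** * Uniqueness *)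

Lemma ae_imply d (T : measurableType d) (R : realType) (m : {measure set T -> \bar R})
    (P Q : T -> Prop) : (forall x, P x -> Q x) ->
  {ae m, forall x, P x} -> {ae m, forall x, Q x}.
Proof. by move=> PQ; apply: filterS => x; exact: PQ. Qed.

Lemma ae_imply3 d (T : measurableType d) (R : realType) (m : {measure set T -> \bar R})
    (P Q S U : T -> Prop) : (forall x, P x -> Q x -> S x -> U x) ->
  {ae m, forall x, P x} -> {ae m, forall x, Q x} -> {ae m, forall x, S x} ->
  {ae m, forall x, U x}.
Proof. by move=> H; apply: filterS3 => x; exact: H. Qed.

Section clamp.
Context (R : realType) (M : R).
Hypothesis M0 : 0 <= M.

(** Truncation turns an essentially bounded solution into a representative bounded everywhere. Being
    1-Lipschitz, it keeps the difference of two solutions dominated by the original difference,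
    hence integrable. *)
Definition clamp (s : R) : R := Num.max (- M) (Num.min s M).

Lemma clamp_cases (s : R) : [\/ s <= - M /\ clamp s = - M,
  (- M <= s <= M) /\ clamp s = s | M <= s /\ clamp s = M].
Proof.
have e0 := M0; rewrite /clamp; have [h1|h1] := leP s M.
  have [h2|h2] := leP (- M) s; first by constructor 2; split; lra.
  by constructor 1; split; lra.
have [h2|h2] := leP (- M) M; first by constructor 3; split; lra.
by constructor 3; split; lra.
Qed.

Lemma clamp_bound (s : R) : - M <= clamp s <= M.
Proof. by have e0 := M0; case: (clamp_cases s) => [[h ->]|[h ->]|[h ->]]; lra. Qed.

Lemma clamp_id (s : R) : `|s| <= M -> clamp s = s.
Proof.
by rewrite ler_norml; case: (clamp_cases s) => [[h ->]|[h ->]|[h ->]]; lra.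
Qed.

Lemma clamp_lip (s t : R) : `|clamp s - clamp t| <= `|s - t|.
Proof.
have e0 := M0; rewrite ler_norml; have := ler_norm (s - t); have := ler_norm (t - s).
rewrite [`|t - s|]distrC.
by case: (clamp_cases s) => [[h ->]|[h ->]|[h ->]];
  case: (clamp_cases t) => [[h' ->]|[h' ->]|[h' ->]]; lra.
Qed.

Lemma measurable_clamp : measurable_fun setT clamp.
Proof. by apply: measurable_maxr => //; exact: measurable_minr. Qed.

End clamp.

Theorem theorem3 (R : realType) (N P : nat)
    (lam : {measure set (RN R N) -> \bar R}) (Hlam : is_lebesgue lam)
    (sigma : 'M[R]_(N, P))
    (mu : {measure set (RN R N) -> \bar R})
    (Hmu0 : mu [set ((0%R : 'rV[R]_N) : RN R N)] = 0%E)
    (Hmusym : forall A : set (RN R N), measurable A ->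
        mu [set - x | x in A] = mu A)
    (Hmuloc : forall K : set 'rV[R]_N, compact K -> ~ K 0 ->
        (mu (K : set (RN R N)) < +oo)%E)
    (Hmulevy : (\int[mu]_(z in [set~ ((0%R : 'rV[R]_N) : RN R N)])
                   (Num.min (enorm z ^+ 2) 1)%:E < +oo)%E)
    (phi : R -> R) (Hphi_mono : {homo phi : x y / x <= y})
    (Hphi_cont : continuous phi)
    (f : 'rV[R]_N -> R) (Hf : Linfty lam f) :
  forall w1 w2 : 'rV[R]_N -> R,
    dist_solution lam sigma mu phi f w1 -> L1 lam (fun x => w1 x - f x) ->
    dist_solution lam sigma mu phi f w2 -> L1 lam (fun x => w2 x - f x) ->
    {ae lam, forall x, w1 x = w2 x}.
Proof.
move=> w1 w2 [[mw1 [M1 HM1]] eq1] I1 [[mw2 [M2 HM2]] eq2] I2.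
pose M := Num.max `|M1| `|M2|.
have M0 : 0 <= M by rewrite le_max normr_ge0.
pose v1 (x : RN R N) := clamp M (w1 x); pose v2 (x : RN R N) := clamp M (w2 x).
have mv1 : measurable_fun setT v1 by exact: (measurableT_comp (measurable_clamp M) mw1).
have mv2 : measurable_fun setT v2 by exact: (measurableT_comp (measurable_clamp M) mw2).
have ae1 : {ae lam, forall x, w1 x = v1 x}.
  apply: ae_imply HM1 => x h; rewrite /v1 clamp_id//.
  by apply: le_trans h _; apply: le_trans (ler_norm _) _; rewrite le_max lexx.
have ae2 : {ae lam, forall x, w2 x = v2 x}.
  apply: ae_imply HM2 => x h; rewrite /v2 clamp_id//.
  by apply: le_trans h _; apply: le_trans (ler_norm _) _; rewrite le_max lexx orbT.
have bv1 x : - M <= v1 x <= M by exact: clamp_bound.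
have bv2 x : - M <= v2 x <= M by exact: clamp_bound.
have mphi : measurable_fun setT phi by exact: continuous_measurable_fun.
(* Monotonicity bounds [phi] on the interval by its values at the endpoints. *)
pose m := Num.max `|phi M| `|phi (- M)|.
have bphi t : - M <= t <= M -> `|phi t| <= m.
  move=> /andP[h1 h2]; have := Hphi_mono _ _ h1; have := Hphi_mono _ _ h2.
  have : `|phi M| <= m by rewrite le_max lexx.
  have : `|phi (- M)| <= m by rewrite le_max lexx orbT.
  by rewrite !ler_norml; lra.
have mp1 : measurable_fun setT (fun x : RN R N => phi (v1 x)) by exact: (measurableT_comp mphi mv1).
have mp2 : measurable_fun setT (fun x : RN R N => phi (v2 x)) by exact: (measurableT_comp mphi mv2).
pose W (x : RN R N) := v1 x - v2 x; pose Phi (x : RN R N) := phi (v1 x) - phi (v2 x).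
have mW : measurable_fun setT W by exact: measurable_funB.
have mPhi : measurable_fun setT Phi by exact: measurable_funB.
have PhiM x : `|Phi x| <= m + m.
  by apply: le_trans (ler_normB _ _) _; apply: lerD; exact: bphi.
have IW : Int lam W.
  (* The unknown [f] cancels in [(w1 - f) - (w2 - f)], which is thus an integrable majorant. *)
  apply: Int_le (Int_norm (IntB I1 I2)) => // x.
  by rewrite opprB addrA subrK; exact: clamp_lip.
have PW0 x : 0 <= Phi x * W x.
  rewrite /Phi /W; have [h|/ltW h] := leP (v1 x) (v2 x).
    by apply: mulr_le0; rewrite subr_le0//; exact: Hphi_mono.
  by apply: mulr_ge0; rewrite subr_ge0//; exact: Hphi_mono.
(* Where [|W| <= d] the modulus of continuity gives [eta]; where [|W| > d] the bound [2 m] on [Phi]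
   is at most [(2 m / d) |W|]. *)
have PhiW eta : 0 < eta -> exists2 C, 0 <= C & forall y, `|Phi y| <= eta + C * `|W y|.
  move=> eta0; have [d d0 Hd] := continuous_modulus M Hphi_cont eta0.
  have mm0 : 0 <= m + m by exact: le_trans (normr_ge0 _) (PhiM 0).
  exists ((m + m) / d) => [|y]; first by rewrite divr_ge0// ltW.
  have [h|h] := leP `|W y| d.
    by apply: le_trans (Hd _ _ (bv1 y) h) _; rewrite lerDl mulr_ge0// divr_ge0// ltW.
  apply: le_trans (PhiM y) _; apply: (@le_trans _ _ ((m + m) / d * `|W y|)).
    by rewrite -mulrA ler_peMr// mulrC ler_pdivlMr// mul1r ltW.
  by rewrite lerDr ltW.
have K n : is_kernel lam (mollifier lam n.+1%:R) by apply: mollifier_kernel.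
have WE n (x : RN R N) : convol lam (mollifier lam n.+1%:R) W x =
     \int[lam]_y (Phi y * Lop sigma mu (fun y : 'rV[R]_N => mollifier lam n.+1%:R ((x : 'rV[R]_N) - y)) y).
  have n0 : (0 : R) < n.+1%:R by [].
  pose psi (y : 'rV[R]_N) := mollifier lam n.+1%:R ((x : 'rV[R]_N) - y).
  have tpsi : test_fun psi by exact: mollifier_test_fun.
  have Ipsi : Int lam (psi : RN R N -> R) by exact: (Int_kernel Hlam (K n) x).
  have IL (g : RN R N -> R) : measurable_fun setT g -> (forall y, `|g y| <= m) ->
      Int lam (fun y : RN R N => g y * Lop sigma mu psi y).
    by move=> mg gm; exact: (Int_Phi_Lop Hlam sigma Hmu0 Hmusym Hmulevy n0 mg gm).
  have mL : measurable_fun setT (Lop sigma mu psi : RN R N -> R).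
    have mc : measurable_fun setT (cst 1 : RN R N -> R) by exact: measurable_cst.
    have c1 (y : RN R N) : `|cst 1 y| <= (1 : R) by rewrite normr1.
    have := Int_measurable (Int_Phi_Lop Hlam sigma Hmu0 Hmusym Hmulevy n0 mc c1 x).
    by under eq_fun do rewrite mul1r.
  (* The tested equation is insensitive to null sets, so it holds for the truncated representatives
     as well. *)
  have red (w v : RN R N -> R) : measurable_fun setT w -> measurable_fun setT v ->
      {ae lam, forall x, w x = v x} ->
      \int[lam]_y (w y * psi y - phi (w y) * Lop sigma mu psi y) =
      \int[lam]_y (v y * psi y - phi (v y) * Lop sigma mu psi y).
    move=> mw mv wv; have mpsi := Int_measurable Ipsi.
    have mm (g : RN R N -> R) : measurable_fun setT g ->
        measurable_fun setT (fun y : RN R N => g y * psi y - phi (g y) * Lop sigma mu psi y).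
      move=> mg; apply: measurable_funB; apply: measurable_funM => //.
      exact: (measurableT_comp mphi mg).
    by apply: ae_Rint; [exact: mm|exact: mm|apply: ae_imply wv => y ->].
  have Iv (v : RN R N -> R) : measurable_fun setT v -> (forall x, - M <= v x <= M) ->
      Int lam (fun y : RN R N => v y * psi y) /\ Int lam (fun y : RN R N => phi (v y) * Lop sigma mu psi y).
    move=> mv bv; split.
      by apply: (IntM (M := M)) => // y; rewrite ler_norml.
    by apply: IL => [|y]; [exact: (measurableT_comp mphi mv)|exact: bphi].
  have [Ia1 Ib1] := Iv v1 mv1 bv1; have [Ia2 Ib2] := Iv v2 mv2 bv2.
  have E : \int[lam]_y (v1 y * psi y - phi (v1 y) * Lop sigma mu psi y) =
           \int[lam]_y (v2 y * psi y - phi (v2 y) * Lop sigma mu psi y).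
    rewrite -(red w1 v1 mw1 mv1 ae1) -(red w2 v2 mw2 mv2 ae2) /Rintegral.
    by congr fine; rewrite (eq1 psi tpsi) (eq2 psi tpsi).
  rewrite !RintB// in E.
  transitivity (\int[lam]_y (v1 y * psi y - v2 y * psi y)).
    by apply: eq_Rintegral => y _; rewrite /W mulrBl.
  transitivity (\int[lam]_y
      (phi (v1 y) * Lop sigma mu psi y - phi (v2 y) * Lop sigma mu psi y)).
    by rewrite !RintB//; lra.
  by apply: eq_Rintegral => y _; rewrite /Phi mulrBl.
have IPW : Int lam (fun x => Phi x * W x) by exact: (IntM mPhi PhiM IW).
have PW : \int[lam]_x (Phi x * W x) = 0.
  apply/eqP; rewrite eq_le; apply/andP; split; last exact: Rintegral_ge0.
  exact: (pairing_le0 Hlam Hmu0 Hmusym Hmulevy mPhi PhiM IW PhiW WE).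
have Phi0 : {ae lam, forall x, Phi x = 0}.
  apply: ae_imply (Rint_eq0 IPW PW0 PW) => x /eqP; rewrite mulf_eq0 => /orP[/eqP//|].
  by rewrite subr_eq0 /Phi => /eqP ->; rewrite subrr.
(* With [Phi = 0] almost everywhere the tested equation makes every mollification of [W] vanish,
   while these converge to [W] in L1. *)
have W0 : \int[lam]_x `|W x| = 0.
  have g0 n x : convol lam (mollifier lam n.+1%:R) W x = 0.
    have n0 : (0 : R) < n.+1%:R by [].
    rewrite WE (ae_Rint (g := fun=> 0)).
    - by rewrite Rintegral_cst// mul0r.
    - exact: Int_measurable (Int_Phi_Lop Hlam sigma Hmu0 Hmusym Hmulevy n0 mPhi PhiM x).
    - exact: measurable_cst.
    - by apply: ae_imply Phi0 => y ->; rewrite mul0r.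
  have H := mollify_L1 Hlam K (@mollifier_concentrate R N lam) IW.
  rewrite -(cvg_lim _ H)//; apply/esym/cvg_lim => //.
  under eq_fun do under eq_Rintegral do rewrite g0 sub0r normrN.
  exact: cvg_cst.
have W0' := Rint_eq0 (Int_norm IW) (fun x => normr_ge0 _) W0.
apply: ae_imply3 ae1 ae2 W0' => x -> -> /normr0_eq0/eqP.
by rewrite subr_eq0 => /eqP.
Qed.
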